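(* Let $\mathcal{M}=(G,\{i\},\{j\},V)$, $i\neq j$, be a linear compartmental model (with a leak in every compartment) with $G$ strongly input-output connected and $|E|=2|V|-(\mathrm{dist}(i,j)+2)$. If $G$ has no directed path from compartment $j$ to compartment $i$ but becomes inductively strongly connected (with respect to vertex $i$) when an edge from compartment $j$ to compartment $i$ is added, then $\mathcal{M}$ is an identifiable path/cycle model.
   Context: A linear compartmental model $(G,In,Out,Leak)$ consists of a finite directed graph $G=(V,E)$ (no self-loops, no repeated edges) and subsets $In,Out,Leak\subseteq V$ (input, output and leak compartments; $In,Out$ nonempty). Each edge $j\to i$ carries an independent parameter $a_{ij}$ and each $i\in Leak$ an independent parameter $a_{0i}$. The compartmental matrix $A$ has $A_{ij}=a_{ij}$ if $j\to i\in E$; $A_{ii}=-a_{0i}-\sum_{k:\,i\to k\in E}a_{ki}$ if $i\in Leak$; $A_{ii}=-\sum_{k:\,i\to k\in E}a_{ki}$ if $i\notin Leak$; all other entries $0$. The model is the system $x'=Ax+u$, $y_i=x_i$ for $i\in Out$, with $u_i\equiv 0$ for $i\notin In$. When $Leak=V$, the diagonal entries $a_{ii}:=A_{ii}$ are algebraically independent and are used as parameters in place of the $a_{0i}$. When every vertex has a directed path to every output (which holds under the hypotheses here), the input-output equation for $j\in Out$ is $\det(\partial I-A)\,y_j=\sum_{i\in In}(-1)^{i+j}\det(\partial I-A)_{ij}\,u_i$, where $\partial=d/dt$ and $(\cdot)_{ij}$ means delete row $i$ and column $j$. The coefficient map $c:\mathbb{R}^{|E|+|Leak|}\to\mathbb{R}^k$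 collects all nonzero, nonmonic coefficients (polynomials in the parameters) of these equations over all $j\in Out$. A cycle is a closed directed path with no repeated vertices; to a cycle or directed path associate the monomial that is the product of the parameters of its edges. The diagonal entries $a_{ii}$ count as monomial cycles of length 1 (self-cycles). $G$ is strongly input-output connected if it is connected (as an undirected graph) and every edge lies in a cycle or in a directed path from an input vertex to an output vertex. $\mathrm{dist}(i,j)$ is the minimum length (number of edges) of a directed path from $i$ to $j$. A directed graph on $n$ vertices is inductively strongly connected with respect to a vertex $v$ if its vertices can be ordered $v_1=v,v_2,\ldots,v_n$ so that for each $m=1,\ldots,n$ the induced subgraph on $\{v_1,\ldots,v_m\}$ is strongly connected. A function $f$ of the parameters is locally identifiable (from $c$) if there is a finitely multivalued function $\Phi$ with $\Phi\circ c=f$ (generically). A model $(G,In,Out,V)$ is an identifiable path/cycle model if all of the independent monomial cycles (including self-cycles) and monomial paths from input to output are locally identifiable and each parameter is contained in such a cycle or path. *)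

(* Defs.v *)
From HB Require Import structures.
From mathcomp Require Import all_boot all_order all_algebra.
From mathcomp Require Import reals.
From mathcomp Require Import mpoly.

Set Implicit Arguments.
Unset Strict Implicit.
Unset Printing Implicit Defensive.

Import GRing.Theory.
Local Open Scope ring_scope.

Section Digraphs.

Variables (n : nat) (e : rel 'I_n).

(* A path from x is given by the sequence p of the vertices after x; a cycle
   by the sequence of its vertices. Both are turned into the sequence of their
   arcs, the pair (x, y) standing for the arc x -> y. *)
Definition path_arcs (x : 'I_n) (p : seq 'I_n) : seq ('I_n * 'I_n) :=
  zip (x :: p) p.

Definition cycle_arcs (c : seq 'I_n) : seq ('I_n * 'I_n) := zip c (rot 1 c).

Definition is_cycle (c : seq 'I_n) : Prop := c != [::] /\ ucycle e c.

Definition is_path (x y : 'I_n) (p : seq 'I_n) : Prop :=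
  [/\ path e x p, last x p = y & uniq (x :: p)].

Definition num_edges : nat := #|[set xy : 'I_n * 'I_n | e xy.1 xy.2]|.

(* A shortest path has length less than n. The value is n if there is none. *)
Definition dist (x y : 'I_n) : nat :=
  find (fun k => [exists p : k.-tuple 'I_n, path e x p && (last x p == y)])
       (iota 0 n).

Definition weakly_connected : Prop :=
  forall x y, connect (fun u v => e u v || e v u) x y.

Definition strongly_io_connected (I O : {set 'I_n}) : Prop :=
  weakly_connected /\
  forall x y, e x y ->
    (exists2 c, is_cycle c & (x, y) \in cycle_arcs c) \/
    (exists i j p,
       [/\ i \in I, j \in O, is_path i j p & (x, y) \in path_arcs i p]).

Definition induced (s : seq 'I_n) : rel 'I_n :=
  fun x y => [&& x \in s, y \in s & e x y].

Definition strongly_connected_on (s : seq 'I_n) : Prop :=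
  forall x y, x \in s -> y \in s -> connect (induced s) x y.

Definition inductively_strongly_connected (v : 'I_n) : Prop :=
  exists s : seq 'I_n,
    [/\ perm_eq s (enum 'I_n), ohead s = Some v &
        forall m, (1 <= m <= n)%N -> strongly_connected_on (take m s)].

Definition add_edge (x y : 'I_n) : rel 'I_n :=
  fun u v => e u v || ((u == x) && (v == y)).

End Digraphs.

(* [edge M j i] is the edge j -> i. *)
Record model (n : nat) := Model {
  edge : rel 'I_n;
  edge_irr : irreflexive edge;
  In : {set 'I_n};
  Out : {set 'I_n};
  Leak : {set 'I_n};
  In_neq0 : In != set0;
  Out_neq0 : Out != set0
}.

Section Models.

Variables (R : realType) (n : nat) (M : model n).

(* The index (Some i, j) is that of a_ij and (None, i) is that of a_0i: the
   exterior of the system, compartment 0, is None. *)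
Definition is_param (p : option 'I_n * 'I_n) : bool :=
  match p with
  | (Some i, j) => edge M j i
  | (None, i) => i \in Leak M
  end.

Definition param := {p : option 'I_n * 'I_n | is_param p}.

Definition num_params : nat := #|{: param}|.

(* The indeterminate of index p, and 0 if there is no such parameter. *)
Definition param_var (p : option 'I_n * 'I_n) : {mpoly R[num_params]} :=
  if insub p is Some q then 'X_(enum_rank (q : param)) else 0.

Definition comp_matrix : 'M[{mpoly R[num_params]}]_n :=
  \matrix_(i, j)
    if i == j
    then - param_var (None, i) - \sum_(k | edge M i k) param_var (Some k, i)
    else param_var (Some i, j).

(* The variable of the univariate polynomials is the operator d/dt. *)
Definition io_lhs : {poly {mpoly R[num_params]}} := char_poly comp_matrix.

Definition io_rhs (i j : 'I_n) : {poly {mpoly R[num_params]}} :=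
  cofactor (char_poly_mx comp_matrix) i j.

Definition io_coefs : seq {mpoly R[num_params]} :=
  [seq p <- flatten [seq (io_lhs : seq _) ++
                         flatten [seq (io_rhs i j : seq _) | i <- enum (In M)]
                    | j <- enum (Out M)]
  | (p != 0) && (p != 1)].

Definition coef_map (theta : 'I_num_params -> R) : seq R :=
  [seq p.@[theta] | p <- io_coefs].

(* Generically means off the zero set of a nonzero polynomial. A finitely
   multivalued function maps a point to the finite list of its values. *)
Definition locally_identifiable (f : ('I_num_params -> R) -> R) : Prop :=
  exists (g : {mpoly R[num_params]}) (Phi : seq R -> seq R),
    g != 0 /\
    forall theta, g.@[theta] != 0 -> f theta \in Phi (coef_map theta).

(* Entry (y, x) of the matrix is a_yx if x -> y is an edge, and is the diagonal
   parameter a_xx if x = y. *)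
Definition monomial (s : seq ('I_n * 'I_n)) : {mpoly R[num_params]} :=
  \prod_(xy <- s) comp_matrix xy.2 xy.1.

Inductive path_or_cycle : seq ('I_n * 'I_n) -> Prop :=
| SelfCycle x : path_or_cycle [:: (x, x)]
| Cycle c : is_cycle (edge M) c -> path_or_cycle (cycle_arcs c)
| IOPath i j p : i \in In M -> j \in Out M -> is_path (edge M) i j p ->
    path_or_cycle (path_arcs i p).

(* As all compartments leak, the parameters are the a_yx with x -> y an edge
   and the a_xx. *)
Definition identifiable_path_cycle_model : Prop :=
  [/\ Leak M = [set: 'I_n],
      forall s, path_or_cycle s ->
        locally_identifiable (fun theta => (monomial s).@[theta]) &
      forall x y, (x == y) || edge M x y ->
        exists2 s, path_or_cycle s & (x, y) \in s].

End Models.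

(* Main.v *)
Require Import Defs.
From HB Require Import structures.
From mathcomp Require Import all_boot all_order all_algebra.
From mathcomp Require Import reals.
From mathcomp Require Import fingroup perm.
From mathcomp Require Import mpoly.
From mathcomp Require Import zify ring.
From mathcomp Require polyrcf.

Set Implicit Arguments.
Unset Strict Implicit.
Unset Printing Implicit Defensive.

Import GRing.Theory Num.Theory.
Local Open Scope ring_scope.

(** The number of edges forces the input i and the output j to be adjacent.
    Indeed, when j -> i is added, every vertex other than i has an edge from and
    an edge to the vertices before it in the inductive order. This makes
    2(n - 1) edges, and there are only 2n - dist(i, j) - 1. So dist(i, j) = 1,
    and there is no other edge. As the only earlier neighbour of j is i, the
    vertices can be renumbered with i first and j second ([vertex_numbering]).

    Conjugating the compartmental matrix A by a diagonal matrix whose entries at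
    i and j are equal preserves the characteristic polynomial p of A, the cofactor
    q on the right-hand side of the equation, and the monomial cycles and paths.
    Off the zero set of the edge parameters, it also makes the parameter of the
    edge into each v <> i, j from the earlier vertices equal to 1. So it
    suffices to work on this slice, which has N = 2n - 1 coordinates: the n
    diagonal entries, the parameter of i -> j, and those of the n - 2 other
    edges ([gauge_fixing], [slice_values]).

    If N of the coefficients of p and q, as polynomials on the slice, are
    algebraically independent, then every polynomial f on the slice is algebraic
    over them: by a dimension count, N + 1 polynomials in N variables satisfy a
    relation ([algebraic_relation]), and one of its coefficients, as a
    polynomial in f, does not vanish identically. The finitely many values of f
    at given values of the coefficients are the roots of that polynomial.

    Independence follows from the Jacobian criterion ([jacobian_independent]).
    Write adj for the adjugate of X - A. Differentiating adj (X - A) = p gives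
    p dq = q dp + (adj dA adj)_(j, i), so the differential of (p, q) is injective
    at a point where the polynomials adj_(j, x) adj_(y, i), for (x, y) among the
    N free positions of A, are linearly independent over the field
    ([slice_coefs_independent]).

    Such a point is found by induction on the number of vertices
    ([generic_slice_step]). Let v be a new vertex with diagonal entry zeta, an
    in-edge from u with parameter 1 and an out-edge to r with parameter w. At
    w = 0 the old products are multiplied by (X - zeta)^2, while the products for
    the out-edge and (once divided by w) for the diagonal entry of v become
    (X - zeta) f and f, where f = adj_(j, r) adj_(u, i) for the old matrix. As
    f <> 0 by the induction hypothesis, zeta can be chosen with f(zeta) <> 0,
    and orders of vanishing at zeta show that the products are independent at
    w = 0, hence at some w <> 0 ([independent_specialization]). *)

(** * Algebraic dependence of multivariate polynomials *)

Lemma msizeM_leS (F : fieldType) N (p q : {mpoly F[N]}) d1 d2 :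
  (msize p <= d1.+1)%N -> (msize q <= d2.+1)%N ->
  (msize (p * q) <= (d1 + d2).+1)%N.
Proof.
move=> hp hq; case: (eqVneq p 0) => [->|p0]; first by rewrite mul0r msize0.
case: (eqVneq q 0) => [->|q0]; first by rewrite mulr0 msize0.
by rewrite msizeM //; move: (msize p) (msize q) hp hq => a b; lia.
Qed.

Lemma msizeX_leS (F : fieldType) N (p : {mpoly F[N]}) d k :
  (msize p <= d.+1)%N -> (msize (p ^+ k) <= (k * d).+1)%N.
Proof.
move=> hp; elim: k => [|k IH]; first by rewrite expr0 msize1.
by rewrite exprS mulSn; apply: msizeM_leS.
Qed.

Lemma msize_prod_leS (F : fieldType) N (I : Type) (r : seq I)
    (p : I -> {mpoly F[N]}) d :
  (forall i, (msize (p i) <= d.+1)%N) ->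
  (msize (\prod_(i <- r) p i) <= (size r * d).+1)%N.
Proof.
move=> hp; elim: r => [|i r IH]; first by rewrite big_nil msize1.
by rewrite big_cons mulSn; apply: msizeM_leS.
Qed.

(** More vectors than coordinates are linearly dependent. *)
Lemma dependent_family (F : fieldType) (I J : finType) (a : I -> J -> F) :
  (#|J| < #|I|)%N ->
  exists2 v : I -> F, exists i, v i != 0 &
    forall j, \sum_i v i * a i j = 0.
Proof.
move=> hc; pose A := \matrix_(i < #|I|, j < #|J|) a (enum_val i) (enum_val j).
have : ~~ row_free A.
  by apply: contraL hc => /eqP h; rewrite -leqNgt -h rank_leq_col.
rewrite -kermx_eq0 => /rowV0Pn [v /sub_kermxP vA v0].
exists (fun i => v 0 (enum_rank i)).
  by have /rV0Pn [k hk] := v0; exists (enum_val k); rewrite enum_valK.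
move=> j; have /rowP /(_ (enum_rank j)) := vA; rewrite !mxE; apply: etrans.
rewrite (reindex (@enum_rank I)); last by apply: onW_bij; apply: enum_rank_bij.
by apply: eq_bigr => k _; rewrite !mxE !enum_rankK.
Qed.

(** Over a field, N + 1 polynomials in N variables satisfy an algebraic
    relation: there are more monomials of exponents less than D in N + 1
    variables than coefficients in their values, once D is large. The relation
    is presented as a polynomial in the last of them. *)
Lemma algebraic_relation (F : fieldType) N (c : N.-tuple {mpoly F[N]})
    (f : {mpoly F[N]}) :
  exists D (q : 'I_D -> {mpoly F[N]}),
    (exists b, q b != 0) /\ \sum_(b < D) (q b \mPo c) * f ^+ b = 0.
Proof.
(* d bounds the degrees of c and f, D the exponents and E, strictly, the
   degrees of the products. *)
pose d := (\max_i msize (tnth c i) + msize f)%N.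
have hc k : (msize (tnth c k) <= d.+1)%N.
  by apply: leqW; apply: leq_trans (leq_addr _ _); apply: (leq_bigmax k).
have hf : (msize f <= d.+1)%N by apply: leqW; rewrite leq_addl.
pose D := ((N.+1 * d).+1 ^ N).+1.
pose E := (N * (D * d) + D * d).+1.
pose I := ({ffun 'I_N -> 'I_D} * 'I_D)%type; pose J := {ffun 'I_N -> 'I_E}.
pose mon (a : {ffun 'I_N -> 'I_D}) : 'X_{1..N} := [multinom (a k : nat) | k < N].
pose mo (x : I) := ('X_[mon x.1] \mPo c) * f ^+ x.2.
have hmo x : (msize (mo x) <= E)%N.
  apply: msizeM_leS; last first.
    apply: leq_trans (msizeX_leS x.2 hf) _.
    by rewrite ltnS leq_mul2r orbC ltnW // ltn_ord.
  rewrite comp_mpolyX; apply: leq_trans (msize_prod_leS (d := (D * d)%N) _ _) _.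
    move=> k; apply: leq_trans (msizeX_leS _ (hc k)) _.
    by rewrite mnmE ltnS leq_mul2r orbC ltnW // ltn_ord.
  by rewrite ltnS /index_enum -enumT size_enum_ord.
have [|v [[a0 b0] v0] hv] :=
    @dependent_family F I J (fun x y => (mo x)@_[multinom (y k : nat) | k < N]).
  rewrite card_prod !card_ffun !card_ord.
  apply: (@leq_ltn_trans (((N.+1 * d).+1 * D) ^ N)%N).
    have hE : (E <= (N.+1 * d).+1 * D)%N.
      by rewrite /E mulSn -mulSnr; have : (0 < D)%N by []; nia.
    by elim: (N in (_ ^ N <= _ ^ N)%N) => // e IH; rewrite !expnS leq_mul.
  by rewrite expnMn mulnC ltn_pmul2l // expn_gt0.
have mon_inj : injective mon.
  move=> a a' /mnmP h; apply/ffunP => k; apply: val_inj.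
  by have := h k; rewrite !mnmE.
exists D, (fun b => \sum_a v (a, b) *: 'X_[mon a]); split.
  exists b0; apply: contra v0 => /eqP /(congr1 (mcoeff (mon a0))).
  rewrite mcoeff0 raddf_sum (bigD1 a0) //= big1 => [|a ha].
    by rewrite addr0 mcoeffZ mcoeffX eqxx mulr1 => ->.
  by rewrite mcoeffZ mcoeffX (inj_eq mon_inj) (negPf ha) mulr0.
have -> : \sum_(b < D) (\sum_a v (a, b) *: 'X_[mon a] \mPo c) * f ^+ b
          = \sum_x v x *: mo x.
  rewrite [RHS](eq_bigr (fun x => v (x.1, x.2) *: mo (x.1, x.2))); last by case.
  rewrite -(pair_bigA _ (fun a b => v (a, b) *: mo (a, b))) /= exchange_big /=.
  apply: eq_bigr => b _; rewrite raddf_sum mulr_suml; apply: eq_bigr => a _.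
  by rewrite /= comp_mpolyZ -scalerAl.
apply/mpolyP => m; rewrite mcoeff0 raddf_sum /=.
under eq_bigr do rewrite mcoeffZ.
case: (ltnP (mdeg m) E) => hm; last first.
  apply: big1 => x _; rewrite memN_msupp_eq0 ?mulr0 //.
  by apply: msize_mdeg_ge; apply: leq_trans (hmo x) _.
have hmk k : (m k < E)%N.
  by apply: leq_ltn_trans hm; rewrite mdegE (bigD1 k) //= leq_addr.
apply: etrans (hv [ffun k => Ordinal (hmk k)]).
apply: eq_bigr => x _; congr (_ * mcoeff _ _).
by apply/mnmP => k; rewrite mnmE ffunE.
Qed.

(** The chain rule. *)
Lemma mderiv_comp_mpoly (F : fieldType) N K (c : K.-tuple {mpoly F[N]})
    (p : {mpoly F[K]}) (l : 'I_N) :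
  (p \mPo c)^`M(l) = \sum_k (p^`M(k) \mPo c) * (tnth c k)^`M(l).
Proof.
pose good p := (p \mPo c)^`M(l) = \sum_k (p^`M(k) \mPo c) * (tnth c k)^`M(l).
have gM p1 p2 : good p1 -> good p2 -> good (p1 * p2).
  rewrite /good rmorphM /= mderivM => -> ->.
  rewrite mulr_suml mulr_sumr -big_split /=; apply: eq_bigr => k _.
  by rewrite mderivM rmorphD !rmorphM /=; ring.
have gC a : good a%:MP.
  rewrite /good comp_mpolyC mderivC big1 // => k _.
  by rewrite mderivC comp_mpoly0 mul0r.
have gX k : good 'X_k.
  rewrite /good comp_mpolyXU -tnth_nth (bigD1 k) //= big1 => [|k' hk'].
    rewrite mderivX mnm1E eqxx scale1r -{1}[U_(k)%MM]add0m addmK mpolyX0.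
    by rewrite comp_mpoly1 mul1r addr0.
  by rewrite mderivX mnm1E eq_sym (negPf hk') scale0r comp_mpoly0 mul0r.
have gXn k e : good ('X_k ^+ e).
  elim: e => [|e IH]; first by rewrite expr0 -mpolyC1.
  by rewrite exprS; apply: gM.
elim/mpolyind: p => [|a m p _ _ IH]; first by rewrite -[0]mpolyC0; apply: gC.
have gm : good (a *: 'X_[m]).
  rewrite -mul_mpolyC; apply: (gM) => //; rewrite mpolyXE_id.
  by elim/big_rec: _ => [|k q _ hq]; [rewrite -mpolyC1; apply: gC | apply: gM].
rewrite raddfD /= mderivD gm IH -big_split; apply: eq_bigr => k _.
by rewrite mderivD raddfD /= mulrDl.
Qed.

(** The Jacobian criterion: in characteristic 0, polynomials with a nonzero
    Jacobian determinant are algebraically independent. A relation of least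
    degree would have partial derivatives that are also relations. *)
Lemma jacobian_independent (F : numFieldType) N (c : N.-tuple {mpoly F[N]}) :
  \det (\matrix_(l, k) (tnth c k)^`M(l)) != 0 ->
  forall p : {mpoly F[N]}, p \mPo c = 0 -> p = 0.
Proof.
set J := \matrix_(_, _) _ => hJ p.
have [d] := ubnP (msize p); elim: d p => // d IH p hp hc.
have hd k : p^`M(k) \mPo c = 0.
  pose v := \col_k (p^`M(k) \mPo c).
  have Jv : J *m v = 0.
    apply/colP => l; rewrite !mxE; have : (p \mPo c)^`M(l) = 0 by rewrite hc mderiv0.
    rewrite mderiv_comp_mpoly; apply: etrans.
    by apply: eq_bigr => k' _; rewrite !mxE mulrC.
  have : \det J *: v = 0.
    by rewrite -mul_scalar_mx -mul_adj_mx -mulmxA Jv mulmx0.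
  by move=> /colP /(_ k); rewrite !mxE => /eqP; rewrite mulf_eq0 (negPf hJ) => /eqP.
have dp0 k : p^`M(k) = 0.
  have [//|h0] := eqVneq (p^`M(k)) 0; apply: IH (hd k).
  have : mlead p^`M(k) \in msupp p^`M(k) by apply: mlead_supp.
  rewrite mcoeff_msupp mcoeff_mderiv mulrn_eq0 negb_or /= => hm.
  have := msize_mdeg_lt (m := (mlead p^`M(k) + U_(k))%MM) (p := p).
  rewrite mcoeff_msupp mdegD mdeg1 addn1 mlead_deg // => /(_ hm) hlt.
  by rewrite ltnS in hp; apply: leq_trans hp.
have p_mon m : m != 0%MM -> p@_m = 0.
  move=> m0; have [k hk] : exists k, m k != 0%N.
    apply/existsP; apply: contraNT m0 => /existsPn h.
    by apply/eqP/mnmP => k; rewrite mnm0E; apply/eqP; rewrite -[_ == _]negbK h.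
  have := mcoeff_mderiv k p (m - U_(k))%MM.
  rewrite dp0 mcoeff0 submK; last first.
    by apply/mnm_lepP => k'; rewrite mnm1E; case: eqP => // <-; rewrite lt0n.
  by move/esym/eqP; rewrite mulrn_eq0 /= => /eqP.
have pE : p = (p@_0)%:MP.
  apply/mpolyP => m; rewrite mcoeffC; case: eqVneq => [->|hm]; first by rewrite mulr1.
  by rewrite mulr0 p_mon.
by move: hc; rewrite pE comp_mpolyC => ->.
Qed.

(** * Characteristic polynomials and adjugates of similar matrices *)

(** The matrix of the permutation s, with its rows scaled by d. *)
Definition scaled_perm_mx (T : comNzRingType) n (d : 'I_n -> T) (s : 'S_n) :=
  \matrix_(x, a) (d x * (s x == a)%:R).

Lemma mul_scaled_perm_mx (T : comNzRingType) n (C : 'M[T]_n) d (s : 'S_n) x y :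
  (C *m scaled_perm_mx d s) x (s y) = C x y * d y /\
  (scaled_perm_mx d s *m C) x (s y) = d x * C (s x) (s y).
Proof.
rewrite !mxE (bigD1 y) //= big1 => [|z hz]; last first.
  by rewrite !mxE (inj_eq perm_inj) (negPf hz) !mulr0.
rewrite !mxE eqxx mulr1 addr0; split => //.
rewrite (bigD1 (s x)) //= big1 => [|z hz]; last first.
  by rewrite !mxE eq_sym (negPf hz) mulr0 mul0r.
by rewrite !mxE eqxx mulr1 addr0.
Qed.

Section Gauge.

Variable S : idomainType.

Lemma char_poly_mx_cancel n (A : 'M[S]_n) m (C C' : 'M[{poly S}]_(m, n)) :
  C *m char_poly_mx A = C' *m char_poly_mx A -> C = C'.
Proof.
move=> h; have /matrixP e : char_poly A *: C = char_poly A *: C'.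
  by rewrite -!mul_mx_scalar -mul_mx_adj !mulmxA h.
apply/matrixP => x y; have := e x y; rewrite !mxE; apply: mulfI.
exact/monic_neq0/char_poly_monic.
Qed.

(** Two matrices intertwined by a nonsingular matrix, over an integral domain
    in which it need not be invertible. *)
Lemma intertwined_char_poly n (A B P : 'M[S]_n) :
  \det P != 0 -> B *m P = P *m A -> char_poly B = char_poly A.
Proof.
move=> hP h; pose P' := map_mx polyC P.
have h' : char_poly_mx B *m P' = P' *m char_poly_mx A.
  by rewrite /char_poly_mx mulmxBl mulmxBr -!map_mxM h scalar_mxC.
have dP : \det P' != 0 by rewrite det_map_mx polyC_eq0.
by have /(congr1 determinant) := h'; rewrite !det_mulmx mulrC; apply: mulfI.
Qed.

Lemma intertwined_adj n (A B P : 'M[S]_n) :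
  \det P != 0 -> B *m P = P *m A ->
  \adj (char_poly_mx B) *m map_mx polyC P
    = map_mx polyC P *m \adj (char_poly_mx A).
Proof.
move=> hP h; have e := intertwined_char_poly hP h; set P' := map_mx polyC P.
have h' : char_poly_mx B *m P' = P' *m char_poly_mx A.
  by rewrite /char_poly_mx mulmxBl mulmxBr -!map_mxM h scalar_mxC.
apply: (@char_poly_mx_cancel _ A).
rewrite -[LHS]mulmxA -h' mulmxA mul_adj_mx -[\det _]/(char_poly B) e.
by rewrite -mulmxA mul_adj_mx scalar_mxC.
Qed.

(** Renumbering the coordinates by a permutation and rescaling them changes
    neither the characteristic polynomial nor, up to the scaling factors, the
    adjugate of its matrix. *)
Lemma gauge_char_poly n (A B : 'M[S]_n) (d : 'I_n -> S) (s : 'S_n) :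
  (forall x, d x != 0) -> (forall x y, B x y * d y = d x * A (s x) (s y)) ->
  char_poly B = char_poly A /\
  (forall x y, \adj (char_poly_mx B) x y * (d y)%:P
               = (d x)%:P * \adj (char_poly_mx A) (s x) (s y)).
Proof.
move=> hd h; pose P := scaled_perm_mx d s.
have PE : P = diag_mx (\row_x d x) *m perm_mx s.
  apply/matrixP => x y; rewrite mul_diag_mx !mxE; congr (_ * _).
have hP : \det P != 0.
  rewrite PE det_mulmx det_diag det_perm mulf_neq0 ?signr_eq0 //.
  by apply/prodf_neq0 => x _; rewrite mxE.
have hBP : B *m P = P *m A.
  apply/matrixP => x b; rewrite -[b](permKV s); set y := (s^-1)%g b.
  by rewrite /P; have [-> _] := mul_scaled_perm_mx B d s x y;
    have [_ ->] := mul_scaled_perm_mx A d s x y.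
have PM : map_mx polyC P = scaled_perm_mx (polyC \o d) s.
  by apply/matrixP => x a; rewrite !mxE rmorphM rmorph_nat.
split; first exact: intertwined_char_poly hP hBP.
move=> x y; have /matrixP /(_ x (s y)) := intertwined_adj hP hBP.
rewrite PM; have [-> _] := mul_scaled_perm_mx (\adj (char_poly_mx B)) (polyC \o d) s x y.
by have [_ ->] := mul_scaled_perm_mx (\adj (char_poly_mx A)) (polyC \o d) s x y.
Qed.

Lemma renumber_char_poly n (A B : 'M[S]_n) (s : 'S_n) :
  (forall x y, B x y = A (s x) (s y)) ->
  char_poly B = char_poly A /\
  (forall x y, \adj (char_poly_mx B) x y = \adj (char_poly_mx A) (s x) (s y)).
Proof.
move=> h; have [|x y|hc ha] := @gauge_char_poly _ A B (fun=> 1) s.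
- by move=> x; rewrite oner_neq0.
- by rewrite h mulr1 mul1r.
by split => // x y; have := ha x y; rewrite polyC1 mulr1 mul1r.
Qed.

End Gauge.

(** * Specialisation of a parameter *)

Lemma poly_nonroot (F : numFieldType) (p : {poly F}) :
  p != 0 -> exists x, p.[x] != 0.
Proof.
move=> p0; pose s := [seq (i%:R : F) | i <- iota 0 (size p)].
have us : uniq s.
  by rewrite map_inj_uniq ?iota_uniq //; apply: mulrIn; apply: oner_neq0.
case: (boolP (all (root p) s)) => [h|/allPn [x _ hx]]; last by exists x.
by have := max_poly_roots p0 h us; rewrite size_map size_iota ltnn.
Qed.

(** Linear independence of the first m terms of a sequence of polynomials. *)
Definition independent (F : fieldType) m (g : nat -> {poly F}) :=
  forall a : nat -> F, \sum_(l < m) a l *: g l = 0 ->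
  forall l, (l < m)%N -> a l = 0.

(** Value of a polynomial whose coefficients depend on a parameter. *)
Definition at_param (F : comNzRingType) (w : F) : {poly {poly F}} -> {poly F} :=
  map_poly (horner_eval w).

(** Linear independence at one value of a parameter implies independence at some
    nonzero value: a maximal minor is a nonzero polynomial in the parameter. *)
Lemma independent_specialization (F : numFieldType) m
    (g : nat -> {poly {poly F}}) :
  independent m (fun l => at_param 0 (g l)) ->
  exists2 w, w != 0 & independent m (fun l => at_param w (g l)).
Proof.
move=> h0; pose d := (\max_(l < m) size (g l))%N.
pose C := \matrix_(l < m, t < d) (g l)`_t.
have hg (l : 'I_m) t : (d <= t)%N -> (g l)`_t = 0.
  by move=> ht; apply: nth_default; apply: leq_trans ht; apply: (leq_bigmax l).
pose Cw w := map_mx (horner_eval w) C.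
have sumE w (a : nat -> F) (v := \row_(l < m) a l) :
    v *m Cw w = 0 <-> \sum_(l < m) a l *: at_param w (g l) = 0.
  have e t : (\sum_(l < m) a l *: at_param w (g l))`_t
             = \sum_(l < m) a l * ((g l)`_t).[w].
    rewrite coef_sum; apply: eq_bigr => l _.
    by rewrite coefZ coef_map.
  split=> [/rowP h|h].
    apply/polyP => t; rewrite coef0 e; case: (ltnP t d) => ht; last first.
      by apply: big1 => l _; rewrite hg // horner0 mulr0.
    have := h (Ordinal ht); rewrite !mxE; apply: etrans.
    by apply: eq_bigr => l _; rewrite !mxE.
  apply/rowP => t; rewrite !mxE; have := e t; rewrite h coef0 => /esym; apply: etrans.
  by apply: eq_bigr => l _; rewrite !mxE.
have : row_free (Cw 0).
  apply: inj_row_free => v hv.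
  pose a l := if insub l is Some l' then v 0 l' else 0.
  have av : \row_(l < m) a l = v.
    by apply/rowP => l; rewrite mxE /a insubT //= => hl; congr (v 0 _); apply: val_inj.
  rewrite -av in hv; have := h0 a (proj1 (sumE 0 a) hv) => ha.
  by rewrite -av; apply/rowP => l; rewrite !mxE ha.
case/row_freeP => D hD; pose pi := \det (C *m map_mx polyC D).
have piE w : pi.[w] = \det (Cw w *m D).
  rewrite -[LHS]/(horner_eval w pi) -det_map_mx map_mxM /=; congr (\det (_ *m _)).
  by apply/matrixP => x y; rewrite !mxE /horner_eval hornerC.
have pi0 : pi != 0.
  apply/eqP => h; have := piE 0; rewrite h horner0 hD det1 => /eqP.
  by rewrite eq_sym oner_eq0.
have [|w] := @poly_nonroot _ ('X * pi); first by rewrite mulf_neq0 ?polyX_eq0.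
rewrite hornerM hornerX mulf_eq0 negb_or => /andP [w0 hw].
exists w => // a /(proj2 (sumE w a)) ha l hl.
have uD : Cw w *m D \in unitmx by rewrite unitmxE -piE unitfE.
have /rowP /(_ (Ordinal hl)) : \row_(l < m) a l = 0.
  apply: (can_inj (mulmxK uD)); rewrite mulmxA ha; by rewrite !mul0mx.
by rewrite !mxE.
Qed.

(** * Transfer vectors *)

(** For the matrix b of size k, (X - b) phi = p e_0 and psi (X - b) = p e_1.
    Over an integral domain this determines phi and psi up to a common factor,
    as the multiples of column 0 and of row 1 of the adjugate of X - b. *)
Definition transfer (S : comNzRingType) k (b : nat -> nat -> S)
    (phi psi : nat -> {poly S}) (p : {poly S}) : Prop :=
  (forall x, (x < k)%N ->
     'X * phi x - \sum_(y < k) (b x y)%:P * phi y = if x == 0%N then p else 0) /\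
  (forall y, (y < k)%N ->
     'X * psi y - \sum_(x < k) psi x * (b x y)%:P = if y == 1%N then p else 0).

Definition nat_mx (S : Type) k (b : nat -> nat -> S) : 'M[S]_k :=
  \matrix_(x < k, y < k) b x y.

Lemma char_poly_nat_mx_mull (S : comNzRingType) k b (phi : nat -> {poly S}) x :
  (char_poly_mx (nat_mx k b) *m \col_(y < k) phi y) x 0
  = 'X * phi x - \sum_(y < k) (b x y)%:P * phi y.
Proof.
rewrite /char_poly_mx mulmxBl mul_scalar_mx !mxE; congr (_ - _).
by apply: eq_bigr => y _; rewrite !mxE.
Qed.

Lemma char_poly_nat_mx_mulr (S : comNzRingType) k b (psi : nat -> {poly S}) y :
  ((\row_(x < k) psi x) *m char_poly_mx (nat_mx k b)) 0 y
  = 'X * psi y - \sum_(x < k) psi x * (b x y)%:P.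
Proof.
rewrite /char_poly_mx mulmxBr mul_mx_scalar !mxE; congr (_ - _).
by apply: eq_bigr => x _; rewrite !mxE.
Qed.

Lemma adj_transfer (S : comNzRingType) k b
    (B := char_poly_mx (nat_mx k.+2 b) : 'M[{poly S}]_k.+2) :
  transfer k.+2 b (fun x => \adj B (inord x) (inord 0))
    (fun y => \adj B (inord 1) (inord y)) (\det B).
Proof.
split => x hx.
  have := char_poly_nat_mx_mull b (fun x => \adj B (inord x) (inord 0)) (Ordinal hx).
  move=> <-.
  have -> : \col_(y < k.+2) \adj B (inord y) (inord 0) = col (inord 0) (\adj B).
    by apply/colP => y; rewrite [LHS]mxE [RHS]mxE inord_val.
  rewrite colE mulmxA mul_mx_adj mul_scalar_mx 2!mxE eqxx andbT.
  rewrite -val_eqE /= inordK //; case: (x == 0%N); rewrite ?mulr1 ?mulr0 //.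
have := char_poly_nat_mx_mulr b (fun y => \adj B (inord 1) (inord y)) (Ordinal hx).
move=> <-.
have -> : \row_(y < k.+2) \adj B (inord 1) (inord y) = row (inord 1) (\adj B).
  by apply/rowP => y; rewrite [LHS]mxE [RHS]mxE inord_val.
rewrite rowE -mulmxA mul_adj_mx mul_mx_scalar 2!mxE eqxx /=.
by rewrite -val_eqE /= inordK //; case: (x == 1%N); rewrite ?mulr1 ?mulr0.
Qed.

Lemma transfer_proportional (S : idomainType) k (b : nat -> nat -> S)
    phi psi p phi' psi' p' :
  transfer k b phi psi p -> transfer k b phi' psi' p' ->
  forall x, (x < k)%N -> p' * phi x = p * phi' x /\ p' * psi x = p * psi' x.
Proof.
move=> [h1 h2] [h1' h2'] x hx; set B := char_poly_mx (nat_mx k b).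
have d0 : \det B != 0 by exact/monic_neq0/char_poly_monic.
have e (f : bool) (a c : {poly S}) : a * (if f then c else 0) = if f then a * c else 0.
  by case: f; rewrite ?mulr0.
split.
  pose v := \col_(y < k) (p' * phi y - p * phi' y).
  have Bv : B *m v = 0.
    apply/colP => y.
    rewrite (char_poly_nat_mx_mull b (fun y => p' * phi y - p * phi' y)) mxE.
    transitivity (p' * ('X * phi y - \sum_(z < k) (b y z)%:P * phi z)
                  - p * ('X * phi' y - \sum_(z < k) (b y z)%:P * phi' z)).
      rewrite !mulrBr !mulr_sumr; under eq_bigr do rewrite mulrBr.
      rewrite sumrB.
      under eq_bigr do rewrite mulrCA.
      under [X in _ - (_ - X)]eq_bigr do rewrite mulrCA.
      by ring.
    by rewrite h1 // h1' // !e; case: (_ == 0%N); ring.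
  have : \det B *: v = 0 by rewrite -mul_scalar_mx -mul_adj_mx -mulmxA Bv mulmx0.
  move=> /colP /(_ (Ordinal hx)); rewrite !mxE /= => /eqP.
  by rewrite mulf_eq0 (negPf d0) /= subr_eq0 => /eqP.
pose v := \row_(y < k) (p' * psi y - p * psi' y).
have Bv : v *m B = 0 *m B.
  rewrite mul0mx; apply/rowP => y.
  rewrite (char_poly_nat_mx_mulr b (fun y => p' * psi y - p * psi' y)) mxE.
  transitivity (p' * ('X * psi y - \sum_(z < k) psi z * (b z y)%:P)
                - p * ('X * psi' y - \sum_(z < k) psi' z * (b z y)%:P)).
    rewrite !mulrBr !mulr_sumr; under eq_bigr do rewrite mulrBl.
    rewrite sumrB; under eq_bigr do rewrite -mulrA.
    under [X in _ - (_ - X)]eq_bigr do rewrite -mulrA.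
    by ring.
  by rewrite h2 // h2' // !e; case: (_ == 1%N); ring.
have /rowP /(_ (Ordinal hx)) := char_poly_mx_cancel Bv.
by rewrite !mxE /= => /eqP; rewrite subr_eq0 => /eqP.
Qed.

Lemma transfer_map (S T : comNzRingType) (f : {rmorphism S -> T}) k b phi psi p :
  transfer k b phi psi p ->
  transfer k (fun x y => f (b x y)) (fun x => map_poly f (phi x))
    (fun x => map_poly f (psi x)) (map_poly f p).
Proof.
move=> [h1 h2]; split => x hx; [have := h1 x hx | have := h2 x hx];
  move/(congr1 (map_poly f)); rewrite rmorphB rmorphM /= map_polyX rmorph_sum /=.
  have -> : map_poly f (if x == 0%N then p else 0) = if x == 0%N then map_poly f p else 0.
    by case: ifP; rewrite ?rmorph0.
  move=> <-; congr (_ - _); apply: eq_bigr => y _.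
  by rewrite rmorphM /= map_polyC.
have -> : map_poly f (if x == 1%N then p else 0) = if x == 1%N then map_poly f p else 0.
  by case: ifP; rewrite ?rmorph0.
move=> <-; congr (_ - _); apply: eq_bigr => y _.
by rewrite rmorphM /= map_polyC.
Qed.

(** * Generic matrices *)

Lemma eq_transfer (S : comNzRingType) k (b b' : nat -> nat -> S) phi psi p :
  (forall x y, (x < k)%N -> (y < k)%N -> b x y = b' x y) ->
  transfer k b phi psi p -> transfer k b' phi psi p.
Proof.
move=> e [h1 h2]; split => x hx; [rewrite -h1 // | rewrite -h2 //];
  by congr (_ - _); apply: eq_bigr => y _; rewrite e.
Qed.

Lemma independent_neq0 (F : fieldType) m (g : nat -> {poly F}) l :
  independent m g -> (l < m)%N -> g l != 0.
Proof.
move=> h hl; apply/eqP => g0.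
have e : \sum_(l' < m) (l' == l :> nat)%:R *: g l' = 0.
  by apply: big1 => l' _; case: eqP => [->|_]; rewrite ?g0 ?scaler0 ?scale0r.
by have /eqP := h (fun l' => (l' == l)%:R) e l hl; rewrite eqxx oner_eq0.
Qed.

Lemma XsubC_combination (F : fieldType) (f q : {poly F}) (b c : F) :
  f.[c] != 0 -> ('X - c%:P) * q + b *: f = 0 -> b = 0 /\ q = 0.
Proof.
move=> fc h; have b0 : b = 0.
  have /eqP := congr1 (horner^~ c) h.
  by rewrite !hornerE subrr mul0r add0r mulf_eq0 (negPf fc) orbF => /eqP.
move/eqP: h; rewrite b0 scale0r addr0 mulf_eq0 polyXsubC_eq0 /= => /eqP.
by [].
Qed.

Section Slice.

(** The input is 0 and the output is 1. A vertex v >= 2 has the in-neighbour u v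
    and the out-neighbour r v among the smaller vertices. *)
Variables u r : nat -> nat.
Hypothesis u_lt : forall v, (2 <= v)%N -> (u v < v)%N.
Hypothesis r_lt : forall v, (2 <= v)%N -> (r v < v)%N.

(** The matrix in which the edge u v -> v has parameter 1 for all v >= 2. The
    sequence z lists the other entries: z (2x) is the diagonal entry at x, z 1
    that of the edge 0 -> 1, and z (2v - 1) that of the edge v -> r v for
    v >= 2. *)
Definition slice_entry (S : nzRingType) (z : nat -> S) (x y : nat) : S :=
  if x == y then z x.*2
  else if (x == 1%N) && (y == 0%N) then z 1%N
  else if (2 <= y)%N && (x == r y) then z y.*2.-1
  else ((2 <= x)%N && (y == u x))%:R.

(** The position (coord_row l, coord_col l) of the coordinate l in the matrix. *)
Definition coord_row l : nat :=
  if odd l then (if l == 1%N then 1%N else r l./2.+1) else l./2.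
Definition coord_col l : nat :=
  if odd l then (if l == 1%N then 0%N else l./2.+1) else l./2.

Lemma coord_lt k l : (l < k.*2.+1)%N -> (coord_row l <= k)%N /\ (coord_col l <= k)%N.
Proof.
rewrite /coord_row /coord_col => hl; have e := odd_double_half l.
case: (boolP (odd l)) e => hodd e; last by split; lia.
case: eqVneq => l1; first by split; lia.
have h2 : (2 <= l./2.+1)%N by lia.
by have := r_lt h2; split; lia.
Qed.

Lemma slice_entry_map (S T : nzRingType) (f : {rmorphism S -> T}) z x y :
  f (slice_entry z x y) = slice_entry (fun l => f (z l)) x y.
Proof.
rewrite /slice_entry; case: ifP => // _; case: ifP => // _; case: ifP => // _.
by rewrite rmorph_nat.
Qed.

Lemma eq_slice_entry (S : nzRingType) k (z z' : nat -> S) x y :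
  (0 < k)%N -> (forall l, (l < k.*2.+1)%N -> z l = z' l) ->
  (x <= k)%N -> (y <= k)%N -> slice_entry z x y = slice_entry z' x y.
Proof.
move=> k0 h hx hy; rewrite /slice_entry; case: ifP => _; first by apply: h; lia.
case: ifP => _; first by apply: h; lia.
by case: ifP => // /andP [y2 _]; apply: h; lia.
Qed.

(** On the vertices 0, ..., k there is a matrix for which the products
    psi_x phi_y, with (x, y) the position of a coordinate, are linearly
    independent. These products are, up to a common factor, the derivatives of
    the transfer function from 0 to 1 along the coordinates. *)
Definition generic_slice (F : fieldType) k : Prop :=
  exists (z : nat -> F) phi psi p,
    [/\ p != 0, transfer k.+1 (slice_entry z) phi psi p &
        independent k.*2.+1 (fun l => psi (coord_row l) * phi (coord_col l))].

(** For two vertices with diagonal entries 0 and 1 the products are X - 1,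
    X (X - 1) and X. *)
Lemma generic_slice1 (F : numFieldType) : generic_slice F 1.
Proof.
pose z l : F := if l == 0%N then 0 else 1.
exists z, (fun x => if x == 0%N then 'X - 1%:P else 1),
  (fun x => if x == 0%N then 1 else 'X), ('X * ('X - 1%:P)).
split.
- by rewrite mulf_neq0 ?polyX_eq0 ?polyXsubC_eq0.
- split; case=> [|[|]] // _;
    by rewrite !big_ord_recl big_ord0 /slice_entry /z /= ?polyC0 ?polyC1; ring.
move=> a; rewrite !big_ord_recl big_ord0 /= -!mul_polyC => h.
have e x : a 0%N * (x - 1) + a 1%N * (x * (x - 1)) + a 2%N * x = 0.
  rewrite -[RHS](horner0 x) -h !(hornerD, hornerM, hornerC, hornerX, hornerN).
  by rewrite /bump /=; ring.
have h0 : a 0%N = 0.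
  by rewrite -[LHS]opprK -[RHS]oppr0 -(e 0); ring.
have h2 : a 2%N = 0 by rewrite -(e 1); ring.
have h1 : a 1%N = 0.
  have := e 2; rewrite h0 h2 !mul0r add0r addr0 => /eqP.
  have -> : a 1%N * (2 * (2 - 1)) = 2 * a 1%N by ring.
  by rewrite mulf_eq0 pnatr_eq0 /= => /eqP.
by case=> [|[|[|]]].
Qed.

Lemma generic_slice_step (F : numFieldType) k :
  (0 < k)%N -> generic_slice F k -> generic_slice F k.+1.
Proof.
move=> k0 [z [phi' [psi' [p' [p'0 tr' ind']]]]].
set v := k.+1.
have uv : (u v < v)%N by apply: u_lt. have rv : (r v < v)%N by apply: r_lt.
pose f := psi' (r v) * phi' (u v).
have f0 : f != 0.
  have hu2 : ((u v).*2 < k.*2.+1)%N by lia.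
  have hr2 : ((r v).*2 < k.*2.+1)%N by lia.
  have := independent_neq0 ind' hu2; have := independent_neq0 ind' hr2.
  rewrite /coord_row /coord_col !odd_double !doubleK /f.
  rewrite !mulf_eq0 !negb_or => /andP [h1 _] /andP [_ h2].
  by rewrite h1.
(* the diagonal entry of the new vertex v = k + 1 *)
have [zeta hzeta] := poly_nonroot f0.
(* The entry of the out-edge of v, coordinate 2k + 1, becomes a variable w; the
   diagonal entry of v is coordinate 2k + 2. *)
pose ext (S : nzRingType) (w ze : S) (zz : nat -> S) l :=
  if l == k.*2.+1 then w else if l == k.*2.+2 then ze else zz l.
pose zw := ext _ 'X zeta%:P (fun l => (z l)%:P).
pose B := char_poly_mx (nat_mx k.+2 (slice_entry zw)).
pose phiw x := \adj B (inord x) (inord 0).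
pose psiw y := \adj B (inord 1) (inord y).
have trw := adj_transfer k (slice_entry zw); rewrite -/B in trw.
pose za w := ext F w zeta z.
pose phi w x := at_param w (phiw x). pose psi w x := at_param w (psiw x).
pose p w := at_param w (\det B).
have tr w : transfer k.+2 (slice_entry (za w)) (phi w) (psi w) (p w).
  apply: eq_transfer (transfer_map (horner_eval w) trw) => x y hx hy.
  rewrite slice_entry_map; apply: (eq_slice_entry (k := k.+1)) => // l _.
  rewrite /= /horner_eval /zw /za /ext.
  by case: (_ == _); [exact: hornerX | case: (_ == _); exact: hornerC].
have p0 w : p w != 0.
  by apply/monic_neq0/monic_map; apply: char_poly_monic.
have eold w x y : (x < v)%N -> (y < v)%N ->
    slice_entry (za w) x y = slice_entry z x y.
  move=> hx hy; apply: (eq_slice_entry (k := k)) => // l hl.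
  by rewrite /za /ext; do 2?[case: eqP => [?|_]; first by lia].
have ecol w x : (x < v)%N -> slice_entry (za w) x v = if x == r v then w else 0.
  move=> hx; rewrite /slice_entry (ltn_eqF hx) andbF /= (_ : (1 < v)%N) //=.
  case: ifP => _; first by rewrite /za /ext eqxx.
  case: ltnP => //= hx2; case: eqP => // e.
  by have := u_lt hx2; rewrite -e; lia.
have erow w y : (y < v)%N -> slice_entry (za w) v y = (y == u v)%:R.
  move=> hy; rewrite /slice_entry (gtn_eqF hy) (_ : (v == 1%N) = false) /=;
    last by apply/eqP; lia.
  case: ifP => [/andP [y2 /eqP e]|_]; first by have := r_lt y2; lia.
  by rewrite (_ : (1 < v)%N).
have ediag w : slice_entry (za w) v v = zeta.
  rewrite /slice_entry eqxx /za /ext /v doubleS.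
  by rewrite eqxx (_ : (_ == _.+1) = false) //; apply/eqP; lia.
pose L := 'X - zeta%:P.
(* At w = 0 the vertex v has no out-edge, so that it is not on any walk from
   the input to the output. *)
pose phie x := if x == v then phi' (u v) else L * phi' x.
pose psie x := if x == v then 0 else L * psi' x.
have phieE x : (x < v)%N -> phie x = L * phi' x by move=> hx; rewrite /phie ltn_eqF.
have psieE x : (x < v)%N -> psie x = L * psi' x by move=> hx; rewrite /psie ltn_eqF.
have phiev : phie v = phi' (u v) by rewrite /phie eqxx.
have psiev : psie v = 0 by rewrite /psie eqxx.
have tre : transfer k.+2 (slice_entry (za 0)) phie psie (L * p').
  have [h1 h2] := tr'.
  split=> x; rewrite ltnS leq_eqVlt big_ord_recr /= -/v => /orP [/eqP ->|hx].
  - under eq_bigr => y _ do rewrite erow // phieE //.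
    rewrite phiev ediag (bigD1 (Ordinal uv)) //= eqxx big1 => [|y]; last first.
      by rewrite -val_eqE /= => /negPf ->; rewrite polyC0 mul0r.
    by rewrite /L polyC1; ring.
  - under eq_bigr => y _ do rewrite eold // phieE // mulrCA.
    rewrite -mulr_sumr phieE // phiev ecol // if_same polyC0 mul0r addr0.
    by rewrite mulrCA -mulrBr h1 //; case: ifP => _; rewrite ?mulr0.
  - under eq_bigr => y _ do rewrite ecol // if_same polyC0 mulr0.
    rewrite psiev big1 // mulr0 mul0r addr0 subr0 (_ : (v == 1%N) = false) //.
    by apply/eqP; lia.
  - under eq_bigr => y _ do rewrite eold // psieE // -mulrA.
    rewrite -mulr_sumr psieE // psiev mul0r addr0.
    by rewrite mulrCA -mulrBr h2 //; case: ifP => _; rewrite ?mulr0.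
have prop := transfer_proportional (tr 0) tre.
have L0 : L != 0 by rewrite polyXsubC_eq0.
have newrow : coord_row k.*2.+1 = r v /\ coord_col k.*2.+1 = v.
  rewrite /coord_row /coord_col /= odd_double /= uphalf_double.
  by rewrite (_ : (k.*2.+1 == 1%N) = false) //; apply/eqP; lia.
have newdiag : coord_row k.*2.+2 = v /\ coord_col k.*2.+2 = v.
  by rewrite /coord_row /coord_col /= odd_double /= doubleK.
(* The product for the diagonal entry of v vanishes at w = 0. As
   (X - zeta) psi_v = w psi_(r v), the product for the out-edge takes its place,
   while the other products are multiplied by X - zeta. *)
pose LL : {poly {poly F}} := 'X - (zeta%:P)%:P.
pose g l := if l == k.*2.+2 then psiw (r v) * phiw v
            else LL * (psiw (coord_row l) * phiw (coord_col l)).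
have LLw w : at_param w LL = L.
  by rewrite /at_param rmorphB /= map_polyX map_polyC /= /horner_eval hornerC.
have gE w l : at_param w (g l) = if l == k.*2.+2 then psi w (r v) * phi w v
            else L * (psi w (coord_row l) * phi w (coord_col l)).
  rewrite /g; case: ifP => _; first by rewrite /at_param rmorphM.
  by rewrite -(LLw w) /at_param !rmorphM.
have ind0 : independent k.+1.*2.+1 (fun l => at_param 0 (g l)).
  move=> a; rewrite doubleS 2!big_ord_recr /= => h.
  set a1 := a k.*2.+1 in h; set a2 := a k.*2.+2 in h.
  pose Sg := \sum_(l < k.*2.+1) a l *: (psi' (coord_row l) * phi' (coord_col l)).
  have key : L * (L * Sg + a1 *: f) + a2 *: f = 0.
    have hc : (p 0) ^+ 2 * L != 0 by rewrite mulf_neq0 ?expf_neq0.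
    apply: (mulfI hc); rewrite mulr0 -[RHS](mulr0 ((L * p') ^+ 2)) -[X in _ = _ * X]h.
    have e x y : (x < v.+1)%N -> (y < v.+1)%N ->
        (L * p') ^+ 2 * (psi 0 x * phi 0 y) = p 0 ^+ 2 * (psie x * phie y).
      move=> hx hy; have [_ ex] := prop x hx; have [ey _] := prop y hy.
      transitivity ((L * p' * psi 0 x) * (L * p' * phi 0 y)); first by ring.
      by rewrite ex ey; ring.
    have eold' (l : 'I_k.*2.+1) : (L * p') ^+ 2 * (a l *: at_param 0 (g l))
        = p 0 ^+ 2 * L * (L ^+ 2 * (a l *: (psi' (coord_row l) * phi' (coord_col l)))).
      have [h1 h2] := coord_lt (ltn_ord l).
      rewrite gE ltn_eqF; last by have := ltn_ord l; lia.
      rewrite -!mul_polyC mulrCA [_ ^+ 2 * (L * _)]mulrCA e ?ltnS ?leqW //.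
      by rewrite psieE ?phieE ?ltnS //; ring.
    have eS : (L * p') ^+ 2 * (\sum_(l < k.*2.+1) a l *: at_param 0 (g l))
        = p 0 ^+ 2 * L * (L ^+ 2 * Sg).
      by rewrite mulr_sumr (eq_bigr _ (fun l _ => eold' l)) -!mulr_sumr.
    rewrite [RHS]mulrDr [X in _ = X + _]mulrDr eS.
    rewrite !gE eqxx ltn_eqF // (proj1 newrow) (proj2 newrow).
    rewrite -!mul_polyC [_ ^+ 2 * (a1%:P * _)]mulrCA [_ ^+ 2 * (a2%:P * _)]mulrCA.
    rewrite [_ ^+ 2 * (L * (psi _ _ * _))]mulrCA !e // ?(ltnW rv) ?ltnS ?(ltnW rv) //.
    by rewrite psieE // phiev /f; ring.
  have [z2 {}key] := XsubC_combination hzeta key.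
  have [z1 {}key] := XsubC_combination hzeta key.
  move=> l hl; case: (eqVneq l k.*2.+2) => [-> //|l2].
  case: (eqVneq l k.*2.+1) => [-> //|l1]; apply: (ind' a key); lia.
have [w w0 indw] := independent_specialization ind0.
exists (za w), (phi w), (psi w), (p w); split => // a h.
have ev : L * psi w v = w%:P * psi w (r v).
  have [_ /(_ v (ltnSn _))] := tr w.
  rewrite big_ord_recr /= -/v ediag (_ : (v == 1%N) = false); last by apply/eqP; lia.
  rewrite (bigD1 (Ordinal rv)) //= ecol // eqxx big1 => [|x].
    by rewrite addr0 => /eqP; rewrite subr_eq0 /L mulrBl => /eqP ->; ring.
  by rewrite -val_eqE /= => hx; rewrite ecol // (negPf hx) polyC0 mulr0.
pose a' l := if l == k.*2.+2 then a l * w else a l.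
have ha' : \sum_(l < k.+1.*2.+1) a' l *: at_param w (g l) = 0.
  rewrite -[RHS](mulr0 L) -[in RHS]h mulr_sumr; apply: eq_bigr => l _.
  rewrite gE /a'; case: eqP => [->|_]; last by rewrite scalerAr.
  rewrite (proj1 newdiag) (proj2 newdiag) -!mul_polyC polyCM.
  rewrite [RHS]mulrCA [L * _]mulrA ev; ring.
move=> l hl; have := indw a' ha' l hl; rewrite /a'; case: ifP => // _ /eqP.
by rewrite mulf_eq0 (negPf w0) orbF => /eqP.
Qed.

Lemma generic_sliceP (F : numFieldType) k : (0 < k)%N -> generic_slice F k.
Proof.
case: k => // k _; elim: k => [|k IH]; first exact: generic_slice1.
exact: generic_slice_step.
Qed.

End Slice.

(** * Algebraic independence of the coefficients *)

(** The partial derivative applied to each coefficient of a polynomial. *)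
Definition cderiv (F : fieldType) N (l : 'I_N) :
  {poly {mpoly F[N]}} -> {poly {mpoly F[N]}} := map_poly (mderiv l).

Lemma char_poly_mxE (S : nzRingType) n (B : 'M[S]_n) x y :
  char_poly_mx B x y = 'X *+ (x == y) - (B x y)%:P.
Proof. by rewrite !mxE. Qed.

(** If dA and - C are the derivatives of adj M and M, then e is that of det M. *)
Lemma adj_variation (T : comNzRingType) n (M dA C : 'M[T]_n) (e : T) :
  dA *m M + \adj M *m (- C) = e%:M ->
  \det M *: dA = e *: \adj M + \adj M *m C *m \adj M.
Proof.
move=> /(congr1 (mulmx^~ (\adj M))).
rewrite mulmxDl -[dA *m M *m _]mulmxA mul_mx_adj mul_mx_scalar.
rewrite mulmxN mulNmx mul_scalar_mx.
by move/eqP; rewrite subr_eq => /eqP.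
Qed.

Lemma mulmx_delta_mulmx (T : nzRingType) m n k (A : 'M[T]_(m, n)) a b
    (C : 'M_(n, k)) x y :
  (A *m delta_mx a b *m C) x y = A x a * C b y.
Proof.
rewrite mxE (bigD1 b) //= big1 => [|z hz]; rewrite mxE (bigD1 a) //= big1.
- by rewrite !addr0 mxE !eqxx mulr1.
- by move=> z hz; rewrite mxE (negPf hz) mulr0.
- by rewrite addr0 mxE (negPf hz) andbF mulr0 mul0r.
- by move=> z' hz'; rewrite mxE (negPf hz') mulr0.
Qed.

Section CoefficientDerivation.

Variables (F : fieldType) (N : nat) (l : 'I_N).
Local Notation S := {mpoly F[N]}.
Implicit Types p q : {poly S}.

Lemma coef_cderiv p t : (cderiv l p)`_t = (p`_t)^`M(l).
Proof. by rewrite coef_map_id0 ?mderiv0. Qed.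

Lemma cderivB p q : cderiv l (p - q) = cderiv l p - cderiv l q.
Proof. by apply/polyP => t; rewrite coefB !coef_cderiv coefB mderivB. Qed.

Lemma cderivM p q : cderiv l (p * q) = cderiv l p * q + p * cderiv l q.
Proof.
apply/polyP => t; rewrite coefD !coefM coef_cderiv coefM raddf_sum -big_split.
by apply: eq_bigr => s _; rewrite /= mderivM !coef_cderiv.
Qed.

Lemma cderivC (c : S) : cderiv l c%:P = (c^`M(l))%:P.
Proof. apply/polyP => t; rewrite coef_cderiv [in RHS]coefC [in LHS]coefC.
by case: (t == 0%N) => //; exact: mderiv0. Qed.

Lemma cderiv_sum (I : Type) (r : seq I) (p : I -> {poly S}) :
  cderiv l (\sum_(i <- r) p i) = \sum_(i <- r) cderiv l (p i).
Proof.
apply/polyP => t; rewrite coef_cderiv !coef_sum raddf_sum.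
by apply: eq_bigr => i _; rewrite coef_cderiv.
Qed.

Lemma cderivXn (b : bool) : cderiv l ('X *+ b : {poly S}) = 0.
Proof.
have d1 : (1 : S)^`M(l) = 0 by rewrite -mpolyC1 mderivC.
apply/polyP => t; rewrite coef_cderiv coef0.
case: b; rewrite ?mulr1n ?mulr0n ?coef0 ?mderiv0 // coefX.
by case: (t == 1%N); [rewrite mulr1n d1 | rewrite mulr0n mderiv0].
Qed.

Lemma map_cderiv_mulmx m n k (A : 'M[{poly S}]_(m, n)) (B : 'M_(n, k)) :
  map_mx (cderiv l) (A *m B)
    = map_mx (cderiv l) A *m B + A *m map_mx (cderiv l) B.
Proof.
apply/matrixP => x y; rewrite !mxE cderiv_sum -big_split; apply: eq_bigr => z _.
by rewrite /= cderivM !mxE.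
Qed.

(** Derivative of the adjugate of X - B. *)
Lemma cderiv_adj n (B : 'M[S]_n) (M := char_poly_mx B) :
  char_poly B *: map_mx (cderiv l) (\adj M)
    = cderiv l (char_poly B) *: \adj M
      + \adj M *m map_mx polyC (map_mx (mderiv l) B) *m \adj M.
Proof.
have dM : map_mx (cderiv l) M = - map_mx polyC (map_mx (mderiv l) B).
  apply/matrixP => x y; rewrite [LHS]mxE char_poly_mxE cderivB cderivXn sub0r.
  by rewrite cderivC [RHS]mxE; congr (- _); rewrite [RHS]mxE; congr (_ %:P); rewrite mxE.
apply: adj_variation; rewrite -dM -map_cderiv_mulmx mul_adj_mx.
apply/matrixP => x y; rewrite [LHS]mxE [X in cderiv l X]mxE [RHS]mxE.
case: (x == y) => //; rewrite !mulr0n.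
exact: map_poly0.
Qed.

End CoefficientDerivation.

Section Independence.

Variables (F : numFieldType) (u r : nat -> nat).
Hypothesis u_lt : forall v, (2 <= v)%N -> (u v < v)%N.
Hypothesis r_lt : forall v, (2 <= v)%N -> (r v < v)%N.
Variable k : nat.
Let N := k.+1.*2.+1.
Local Notation S := {mpoly F[N]}.

(** The coordinates as indeterminates, and 0 beyond the last one. *)
Definition slice_var (l : nat) : S := if insub l is Some i then 'X_i else 0.

(** The generic matrix of the slice, and the two sides of its input-output
    equation. *)
Definition slice_mx : 'M[S]_k.+2 := nat_mx k.+2 (slice_entry u r slice_var).
Definition slice_lhs : {poly S} := char_poly slice_mx.
Definition slice_rhs : {poly S} :=
  \adj (char_poly_mx slice_mx) (inord 1) (inord 0).

(** The coefficients of p and of q in a single sequence. *)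
Definition interleave (T : nmodType) (p q : seq T) t : T :=
  if odd t then q`_t./2 else p`_t./2.

Lemma slice_varE (i : 'I_N) : slice_var i = 'X_i.
Proof. by rewrite /slice_var insubT //= => h; congr ('X_ _); apply: val_inj. Qed.

Lemma map_slice_mx (z : nat -> F) :
  map_mx (meval (fun l : 'I_N => z l)) slice_mx = nat_mx k.+2 (slice_entry u r z).
Proof.
apply/matrixP => i j; rewrite [LHS]mxE [RHS]mxE.
have -> : slice_mx i j = slice_entry u r slice_var i j by rewrite mxE.
rewrite slice_entry_map.
apply: (@eq_slice_entry u r _ k.+1) => // [l hl||]; last 2 first.
- by rewrite -ltnS.
- by rewrite -ltnS.
rewrite -[l]/(nat_of_ord (Ordinal hl)) slice_varE; exact: (mevalXU (fun l : 'I_N => z l)).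
Qed.

Lemma mderiv_slice_var (l : 'I_N) m : (slice_var m)^`M(l) = (m == l)%:R.
Proof.
rewrite /slice_var; case: insubP => [i _ <-|hm].
  rewrite mderivX mnm1E val_eqE; case: eqVneq => [->|_].
    by rewrite scale1r -{1}[U_(l)%MM]add0m addmK mpolyX0.
  by rewrite scale0r.
by rewrite mderiv0; case: eqP => // e; rewrite e ltn_ord in hm.
Qed.

Lemma mderiv_slice_entry (l : 'I_N) x y :
  (slice_entry u r slice_var x y)^`M(l)
    = ((x == coord_row r l) && (y == coord_col l))%:R.
Proof.
rewrite /slice_entry (fun_if (mderiv l)) (fun_if (mderiv l)) (fun_if (mderiv l)).
rewrite !mderiv_slice_var.
have -> (b : bool) : (b%:R : S)^`M(l) = 0.
  by case: b; rewrite ?mulr0n ?mderiv0 // mulr1n -mpolyC1 mderivC.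
transitivity ((if x == y then x.*2 == l
               else if (x == 1%N) && (y == 0%N) then 1%N == l
               else (1 < y)%N && (x == r y) && (y.*2.-1 == l) : bool)%:R : S).
  by do 3?case: ifP => _.
congr (_%:R); congr nat_of_bool; rewrite /coord_row /coord_col.
have e := odd_double_half l; case: (boolP (odd l)) e => hodd e; last first.
  case: eqVneq => hxy; first by apply/idP/idP; lia.
  case: ifP => _; first by apply/idP/idP; lia.
  by apply/idP/idP => [/andP [/andP [y1 _] h]|h]; lia.
case: (eqVneq (l : nat) 1%N) => l1.
  case: eqVneq => hxy; first by apply/idP/idP; lia.
  case: ifP => h1 //.
  by apply/negP => /andP [/andP [y1 _] h]; lia.
have hr := @r_lt l./2.+1.
case: (eqVneq y l./2.+1) => [->|hy].
  case: eqVneq => hxy; first by apply/idP/idP; lia.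
  case: ifP => h1; first by apply/idP/idP; lia.
  rewrite andbT; apply/idP/idP => [/andP [/andP [_ ->] _] //|->].
  by rewrite andbT; lia.
rewrite andbF; case: eqVneq => hxy; first by apply/eqP; lia.
case: ifP => _; first by apply/eqP; lia.
by apply/negP => /andP [/andP [y1 _] h]; lia.
Qed.

(** At a generic point the differential of the coefficients of slice_lhs and
    slice_rhs is injective, so that as many of them as there are coordinates are
    algebraically independent. *)
Lemma slice_coefs_independent : exists g : 'I_N -> nat,
  forall p : {mpoly F[N]},
    p \mPo [tuple interleave (slice_lhs : seq _) slice_rhs (g l) | l < N] = 0 ->
    p = 0.
Proof.
have [z [phi [psi [p0 [p0n tr ind]]]]] := generic_sliceP u_lt r_lt F (ltn0Sn k).
pose v (l : 'I_N) := z l.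
pose B0 := char_poly_mx (nat_mx k.+2 (slice_entry u r z)).
pose T := (maxn (size slice_lhs) (size slice_rhs)).*2.
pose c t := interleave (slice_lhs : seq _) slice_rhs t.
have cT t : (T <= t)%N -> c t = 0.
  rewrite /T -geq_half_double geq_max => /andP [hP hQ].
  by rewrite /c /interleave; case: (odd t); apply: nth_default.
pose J := \matrix_(t < T, l < N) ((c t)^`M(l)).@[v].
pose ev := map_poly (meval v).
have evB x y : ev (\adj (char_poly_mx slice_mx) x y) = \adj B0 x y.
  have -> : B0 = map_mx ev (char_poly_mx slice_mx).
    by rewrite map_char_poly_mx map_slice_mx.
  by rewrite -map_mx_adj [RHS]mxE.
have key (l : 'I_N) :
    ev slice_lhs * ev (cderiv l slice_rhs) = ev (cderiv l slice_lhs) * ev slice_rhs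
    + \adj B0 (inord 1) (inord (coord_row r l)) * \adj B0 (inord (coord_col l)) (inord 0).
  have dB : map_mx polyC (map_mx (mderiv l) slice_mx)
      = delta_mx (inord (coord_row r l)) (inord (coord_col l)).
    apply/matrixP => x y; rewrite 3!mxE mderiv_slice_entry rmorph_nat [RHS]mxE.
    have [hx hy] := coord_lt r_lt (ltn_ord l).
    by rewrite -!val_eqE /= !inordK.
  have := cderiv_adj l slice_mx; rewrite dB => /matrixP /(_ (inord 1) (inord 0)).
  rewrite [LHS]mxE [X in _ * X = _]mxE [RHS]mxE mulmx_delta_mulmx [X in X + _]mxE.
  move/(congr1 ev); rewrite /ev rmorphD !rmorphM /= -/ev => ->.
  by rewrite !evB.
have full : row_full J.
  rewrite -[row_full _]/(\rank J == N) -mxrank_tr; apply: inj_row_free => h hJ.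
  have rel t : \sum_l h 0 l * ((c t)^`M(l)).@[v] = 0.
    case: (ltnP t T) => ht; last first.
      by apply: big1 => l _; rewrite cT // mderiv0 meval0 mulr0.
    have /rowP /(_ (Ordinal ht)) := hJ; rewrite !mxE; apply: etrans.
    by apply: eq_bigr => l _; rewrite !mxE.
  have relP (q : {poly S}) s : (forall t, q`_t = c (s t)) ->
      \sum_l h 0 l *: ev (cderiv l q) = 0.
    move=> hq; apply/polyP => t; rewrite coef_sum coef0; apply: etrans (rel (s t)).
    by apply: eq_bigr => l _; rewrite coefZ coef_map coef_cderiv hq.
  have dP : \sum_l h 0 l *: ev (cderiv l slice_lhs) = 0.
    by apply: (relP _ double) => t; rewrite /c /interleave odd_double doubleK.
  have dQ : \sum_l h 0 l *: ev (cderiv l slice_rhs) = 0.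
    apply: (relP _ (fun t => t.*2.+1)) => t.
    by rewrite /c /interleave /= odd_double /= uphalf_double.
  pose A x y := \adj B0 (inord x) (inord y).
  have dF : \sum_l h 0 l *: (A 1%N (coord_row r l) * A (coord_col l) 0%N) = 0.
    have : \sum_l h 0 l *: (ev slice_lhs * ev (cderiv l slice_rhs)) = 0.
      under eq_bigr do rewrite scalerAr.
      by rewrite -mulr_sumr dQ mulr0.
    under eq_bigr do rewrite key scalerDr scalerAl.
    by rewrite big_split /= -mulr_suml dP mul0r add0r.
  (* dF relates products which, up to a factor, are independent at z *)
  have prop := transfer_proportional (adj_transfer k (slice_entry u r z)) tr.
  have d0 : \det B0 != 0 by apply/monic_neq0/char_poly_monic.
  have dF' : \sum_(l < N) h 0 (inord l) *: (psi (coord_row r l) * phi (coord_col l)) = 0.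
    have d20 : \det B0 ^+ 2 != 0 by rewrite expf_neq0.
    apply: (mulfI d20); rewrite mulr0 -[RHS](mulr0 (p0 ^+ 2)) -[in RHS]dF !mulr_sumr.
    apply: eq_bigr => l _; rewrite inord_val -!scalerAr; congr (_ *: _).
    have [hr hc] := coord_lt r_lt (ltn_ord l).
    have [_ er] := prop (coord_row r l) hr; have [ec _] := prop (coord_col l) hc.
    transitivity ((\det B0 * psi (coord_row r l)) * (\det B0 * phi (coord_col l))).
      by ring.
    by rewrite -er -ec /A; ring.
  apply/rowP => l; rewrite mxE -[l]inord_val.
  exact: (ind (fun l => h 0 (inord l)) dF').
exists (fun l => fullrankfun full l : nat); apply: jacobian_independent.
set Jg := \matrix_(l, m) _.
have : (rowsub (fullrankfun full) J)^T \in unitmx by rewrite unitmx_tr fullrowsub_unit.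
have -> : (rowsub (fullrankfun full) J)^T = map_mx (meval v) Jg.
  apply/matrixP => l m; rewrite !mxE tnth_mktuple //.
rewrite unitmxE det_map_mx unitfE; apply: contraNneq => ->; exact/eqP/meval0.
Qed.

End Independence.

(** * The structure of the graph *)

Lemma index_filter_lt (T : eqType) (P : pred T) (s : seq T) x y :
  P x -> P y -> (index x s < index y s)%N ->
  (index x (filter P s) < index y (filter P s))%N.
Proof.
move=> Px Py; elim: s => //= h s IH.
case: (eqVneq h x) => [->|hx]; first by rewrite Px /= eqxx; case: eqVneq.
case: (eqVneq h y) => [->|hy] // h'.
case: (P h) => /=; last exact: IH.
by rewrite (negPf hx) (negPf hy) ltnS; apply: IH.
Qed.

Lemma find_iota_eq1 n (P : pred nat) :
  (1 < n)%N -> find P (iota 0 n) = 1%N -> P 1%N.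
Proof.
case: n => [|[|n]] //= _; case: (P 0%N) => //=.
by case: (P 1%N).
Qed.

Lemma find_iota_gt0 n (P : pred nat) :
  (0 < n)%N -> ~~ P 0%N -> (0 < find P (iota 0 n))%N.
Proof. by case: n => //= n _ /negPf ->. Qed.

Section Graph.

Variables (n : nat) (e : rel 'I_n) (i j : 'I_n).
Hypothesis e_irr : irreflexive e.
Hypothesis hij : i != j.
Hypothesis hE : num_edges e = (2 * n - (dist e i j + 2))%N.
Hypothesis hji : ~~ connect e j i.
Hypothesis hisc : inductively_strongly_connected (add_edge e j i) i.

(** The edges of the graph completed with j -> i. *)
Let a := add_edge e j i.

Lemma n_gt1 : (1 < n)%N.
Proof.
have hi := ltn_ord i; have hj := ltn_ord j.
by move: hij; rewrite -val_eqE /=; lia.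
Qed.

Lemma no_back_edge : ~~ e j i.
Proof. by apply: contra hji; apply: connect1. Qed.

Lemma add_edge_irr x : a x x = false.
Proof.
rewrite /a /add_edge e_irr; apply/negP => /andP [/eqP -> /eqP h].
by move: hij; rewrite h eqxx.
Qed.

Lemma edgeE x y : e x y = a x y && ((x, y) != (j, i)).
Proof.
rewrite /a /add_edge xpair_eqE.
case: (boolP ((x == j) && (y == i))) => [/andP [/eqP -> /eqP ->]|_].
  by rewrite andbF (negPf no_back_edge).
by rewrite orbF andbT.
Qed.

Lemma dist_gt0 : (0 < dist e i j)%N.
Proof.
apply: find_iota_gt0; first by have := n_gt1; lia.
apply/existsPn => p; rewrite (tuple0 p) /=; exact: hij.
Qed.

Lemma dist_eq1 : dist e i j = 1%N -> e i j.
Proof.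
move/(find_iota_eq1 n_gt1)/existsP => [p]; case/tupleP: p => w p.
by rewrite (tuple0 p) /= andbT => /andP [h /eqP <-].
Qed.

Lemma num_add_edges : #|[set xy : 'I_n * 'I_n | a xy.1 xy.2]| = (num_edges e).+1.
Proof.
have -> : [set xy : 'I_n * 'I_n | a xy.1 xy.2] = (j, i) |: [set xy | e xy.1 xy.2].
  by apply/setP => -[x y]; rewrite !inE /a /add_edge xpair_eqE orbC.
by rewrite cardsU1 inE /= no_back_edge.
Qed.

(** Each vertex added in the inductive construction has an edge from and an edge
    to the vertices before it; the number of edges leaves room for no other. *)
Lemma construction_order : exists (s : seq 'I_n) (inn out : 'I_n -> 'I_n),
  [/\ perm_eq s (enum 'I_n), index i s = 0%N,
      forall v, v != i -> (index (inn v) s < index v s)%N /\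
                          (index (out v) s < index v s)%N,
      forall x y, a x y = (y != i) && (x == inn y) || (x != i) && (y == out x) &
      e i j].
Proof.
have [s [hs hi hm]] := hisc.
have us : uniq s by rewrite (perm_uniq hs) enum_uniq.
have ms v : v \in s by rewrite (perm_mem hs) mem_enum.
have ss : size s = n by rewrite (perm_size hs) size_enum_ord.
have i0 : index i s = 0%N by case: (s) hi => //= h s' [->]; rewrite eqxx.
have conn v (m := (index v s).+1) : v != i ->
    [/\ connect (induced a (take m s)) v i, connect (induced a (take m s)) i v
       & forall w, w \in take m s -> (index w s <= index v s)%N].
  move=> hv; have hmn : (1 <= m <= n)%N by have := index_mem v s; rewrite ss ms.
  have vt : v \in take m s by rewrite in_take // /m.
  have it : i \in take m s by rewrite in_take // i0.
  split; [exact: hm | exact: hm | by move=> w; rewrite in_take // ltnS].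
have lt w v : (index w s <= index v s)%N -> w != v -> (index w s < index v s)%N.
  move=> h hwv; rewrite ltn_neqAle h andbT; apply: contra hwv => /eqP h'.
  by rewrite -(nth_index i (ms w)) h' nth_index.
have neq x y : a x y -> x != y by apply: contraTneq => ->; rewrite add_edge_irr.
have exout v : v != i -> exists w, a v w && (index w s < index v s)%N.
  move=> hv; have [/connectP [[|w p] /= hp hl] _ ht] := conn v hv.
    by rewrite hl eqxx in hv.
  have /andP [/and3P [_ hw avw] _] := hp.
  by exists w; rewrite avw lt ?ht // eq_sym neq.
have exin v : v != i -> exists w, a w v && (index w s < index v s)%N.
  move=> hv; have [_ /connectP [p hp hl] ht] := conn v hv.
  case/lastP: p hp hl => [|p w] /=; first by move=> _ h; rewrite h eqxx in hv.
  rewrite rcons_path last_rcons => /andP [_ /and3P [hw _ awv]] hvw.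
  by exists (last i p); rewrite -hvw in awv; rewrite awv lt ?ht // neq.
pose inn v := odflt v [pick w | a w v && (index w s < index v s)%N].
pose out v := odflt v [pick w | a v w && (index w s < index v s)%N].
have innP v : v != i -> a (inn v) v /\ (index (inn v) s < index v s)%N.
  move=> /exin [w hw]; rewrite /inn; case: pickP => [w' /andP [] //|h].
  by have := h w; rewrite hw.
have outP v : v != i -> a v (out v) /\ (index (out v) s < index v s)%N.
  move=> /exout [w hw]; rewrite /out; case: pickP => [w' /andP [] //|h].
  by have := h w; rewrite hw.
pose X1 := [set (inn v, v) | v in [set~ i]].
pose X2 := [set (v, out v) | v in [set~ i]].
pose E := [set xy : 'I_n * 'I_n | a xy.1 xy.2].
have cX1 : #|X1| = n.-1.
  rewrite card_imset; last by move=> v w [].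
  by rewrite cardsC1 card_ord.
have cX2 : #|X2| = n.-1.
  rewrite card_imset; last by move=> v w [].
  by rewrite cardsC1 card_ord.
have X12 : X1 :&: X2 = set0.
  apply/setP => xy; rewrite !inE; apply/negP => /andP [/imsetP [v hv ->]].
  move=> /imsetP [w hw [h1 h2]]; rewrite !inE in hv hw.
  have [_ l1] := innP v hv; have [_ l2] := outP w hw.
  by rewrite -h2 -h1 in l2; have := ltn_trans l1 l2; rewrite ltnn.
have sX : X1 :|: X2 \subset E.
  apply/subsetP => xy; rewrite !inE => /orP [] /imsetP [v]; rewrite !inE => hv -> /=.
    by have [] := innP v hv.
  by have [] := outP v hv.
have cX : #|X1 :|: X2| = (2 * n.-1)%N by rewrite cardsU X12 cards0 cX1 cX2; lia.
have cE : #|E| = (2 * n - (dist e i j + 2)).+1 by rewrite -hE -num_add_edges.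
have n1 := n_gt1; have d0 := dist_gt0.
have le := subset_leq_card sX; rewrite cX cE in le.
(* 2 (n - 1) <= 2 n - (d + 2) + 1 leaves only d = 1, with equality *)
have d1 : dist e i j = 1%N by move: (dist e i j) d0 le => d d0 le; lia.
have XE : X1 :|: X2 = E.
  by apply/eqP; rewrite eqEcard sX cX cE d1; lia.
exists s, inn, out; split => //.
- by move=> v hv; have [_ ?] := innP v hv; have [_ ?] := outP v hv.
- move=> x y; have -> : a x y = ((x, y) \in E) by rewrite inE.
  rewrite -XE inE; congr (_ || _).
    apply/imsetP/andP => [[v]|[hy /eqP ->]]; last by exists y; rewrite ?inE.
    by rewrite !inE => hv [-> ->].
  apply/imsetP/andP => [[v]|[hx /eqP ->]]; last by exists x; rewrite ?inE.
  by rewrite !inE => hv [-> ->].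
- exact: dist_eq1.
Qed.

(** With the vertices numbered by t from i and j on, every other vertex v has
    exactly one edge from the vertices before it, u v -> v, and one edge to them,
    v -> r v; the remaining edge is i -> j. *)
Lemma vertex_numbering : exists (t : 'S_n) (u r : nat -> nat),
  [/\ forall v, (2 <= v)%N -> (u v < v)%N, forall v, (2 <= v)%N -> (r v < v)%N,
      forall x : 'I_n, x = 0%N :> nat -> t x = i,
      forall x : 'I_n, x = 1%N :> nat -> t x = j &
      forall x y : 'I_n, e (t y) (t x) =
        [|| (x == 1%N :> nat) && (y == 0%N :> nat), (2 <= y)%N && (x == r y :> nat)
          | (2 <= x)%N && (y == u x :> nat)]].
Proof.
have [s [inn [out [hs i0 hlt aE eij]]]] := construction_order.
have us : uniq s by rewrite (perm_uniq hs) enum_uniq.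
have ms v : v \in s by rewrite (perm_mem hs) mem_enum.
have hji' : j != i by rewrite eq_sym.
have innj : inn j = i.
  have := aE i j; rewrite /a /add_edge eij eqxx hji' /= orbF => /esym/eqP -> //.
have outj : out j = i.
  have := aE j i; rewrite /a /add_edge !eqxx hji' /= orbT => /esym/eqP -> //.
(* No vertex between i and j in the order s is adjacent to j, which can be
   moved to the second place. *)
pose fl := [seq v <- s | (v != i) && (v != j)].
pose l := i :: j :: fl.
have ul : uniq l.
  by rewrite /= !inE !mem_filter !eqxx /= andbF orbF hij filter_uniq.
have ml v : v \in l.
  rewrite !inE mem_filter ms andbT.
  by case: (v == i); case: (v == j).
have sl : size l = n.
  rewrite -[RHS]size_enum_ord; apply/eqP; rewrite eqn_leq !uniq_leq_size ?enum_uniq //.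
  by move=> v _; rewrite mem_enum.
have t_inj : injective (fun x : 'I_n => nth i l x).
  move=> x y /eqP; rewrite nth_uniq ?sl ?ltn_ord // => /eqP h; exact: val_inj.
pose t := perm t_inj.
have tE x : t x = nth i l x by rewrite permE.
have idx x : index (t x) l = x by rewrite tE index_uniq // sl ltn_ord.
have lt v w : v != i -> v != j -> (index w s < index v s)%N ->
    (index w l < index v l)%N.
  move=> vi vj h; rewrite /= ![_ == v]eq_sym (negPf vi) (negPf vj).
  case: eqVneq => // wi; case: eqVneq => // wj; rewrite !ltnS.
  by apply: index_filter_lt; rewrite ?vi // eq_sym wi eq_sym wj.
have t0 (x : 'I_n) : x = 0%N :> nat -> t x = i by move=> h; rewrite tE h.
have t1 (x : 'I_n) : x = 1%N :> nat -> t x = j by move=> h; rewrite tE h.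
have t2 (x : 'I_n) : (2 <= x)%N -> t x != i /\ t x != j.
  move=> hx; split; apply: contraL hx => /eqP h; have := idx x;
    by rewrite h /= eqxx ?(negPf hij) => <-.
pose par (f : 'I_n -> 'I_n) v := if insub v is Some x then index (f (t x)) l else 0%N.
have parE f (x : 'I_n) : par f x = index (f (t x)) l.
  by rewrite /par insubT //= => h; congr (index (f (t _)) l); apply: val_inj.
have par_lt f v : (forall v, v != i -> (index (f v) s < index v s)%N) ->
    (2 <= v)%N -> (par f v < v)%N.
  move=> hf hv; rewrite {1}/par; case: insubP => [x _ hx|_]; last by lia.
  have [h1 h2] : t x != i /\ t x != j by apply: t2; rewrite hx.
  by rewrite -[X in (_ < X)%N]hx -[X in (_ < X)%N]idx; apply: lt => //; apply: hf.
exists t, (par inn), (par out); split => //.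
- by move=> v; apply: par_lt => w hw; have [] := hlt w hw.
- by move=> v; apply: par_lt => w hw; have [] := hlt w hw.
have tl w (x : 'I_n) : (x == index w l :> nat) = (t x == w).
  apply/eqP/eqP => [h|<-]; last by rewrite idx.
  by rewrite tE h nth_index.
have ti (x : 'I_n) : (t x == i) = (x == 0%N :> nat) by rewrite -tl /= eqxx.
have tj (x : 'I_n) : (t x == j) = (x == 1%N :> nat).
  by rewrite -tl /= (negPf hij) eqxx.
move=> x y; rewrite edgeE aE !parE !tl xpair_eqE !ti tj.
have hA : x = 1%N :> nat -> (t y == inn (t x)) = (y == 0%N :> nat).
  by move=> hx; rewrite (t1 x) // innj ti.
have hB : y = 1%N :> nat -> (t x == out (t y)) = (x == 0%N :> nat).
  by move=> hy; rewrite (t1 y) // outj ti.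
move: (t y == _) (t x == _) hA hB.
case: (x : nat) => [|[|X]]; case: (y : nat) => [|[|Y]] A B hA hB //=;
  try rewrite (hA erefl); try rewrite (hB erefl); rewrite ?andbT ?andbF ?orbF //;
  by case: (A); case: (B).
Qed.

End Graph.

(** * Identifiability *)

Lemma comp_mpoly_comp (F : comNzRingType) m n k (p : {mpoly F[m]})
    (c : m.-tuple {mpoly F[n]}) (d : n.-tuple {mpoly F[k]}) :
  (p \mPo c) \mPo d = p \mPo [tuple tnth c l \mPo d | l < m].
Proof.
rewrite [p \mPo c]comp_mpolyE [RHS]comp_mpolyE rmorph_sum /=; apply: eq_bigr => s _.
rewrite comp_mpolyZ rmorph_prod; congr (_ *: _); apply: eq_bigr => l _.
by rewrite /= rmorphXn tnth_mktuple.
Qed.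

Lemma interleave_map (S T : nzRingType) (f : {rmorphism S -> T})
    (p q : {poly S}) t :
  interleave (map_poly f p : seq T) (map_poly f q) t
    = f (interleave (p : seq S) q t).
Proof. by rewrite /interleave !coef_map; case: ifP. Qed.

Lemma prod_path_arcs (F : comNzRingType) n (d : 'I_n -> F) x p :
  d x * \prod_(xy <- path_arcs x p) d xy.2
    = \prod_(xy <- path_arcs x p) d xy.1 * d (last x p).
Proof.
rewrite /path_arcs; elim: p x => [|y p IH] x /=; first by rewrite !big_nil mulr1 mul1r.
by rewrite !big_cons /= IH mulrA.
Qed.

Lemma prod_cycle_arcs (F : comNzRingType) n (d : 'I_n -> F) c :
  \prod_(xy <- cycle_arcs c) d xy.2 = \prod_(xy <- cycle_arcs c) d xy.1.
Proof.
rewrite /cycle_arcs -(big_map snd xpredT d) -(big_map fst xpredT d).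
rewrite -/(unzip1 _) -/(unzip2 _) unzip1_zip ?size_rot // unzip2_zip ?size_rot //.
by apply: perm_big; rewrite perm_rot.
Qed.

Section Model.

Variables (R : realType) (k : nat) (M : model k.+2) (i j : 'I_k.+2).
Hypothesis hIn : In M = [set i].
Hypothesis hOut : Out M = [set j].
Hypothesis hLeak : Leak M = [set: 'I_k.+2].

Local Notation n := k.+2.
Local Notation P := (num_params M).
Local Notation N := (k.+1.*2.+1).
Let A := comp_matrix R M.

Lemma comp_matrix_edge x y : edge M x y -> exists l, A y x = 'X_l.
Proof.
move=> h; have hxy : y == x = false.
  by apply: contraTF h => /eqP ->; rewrite edge_irr.
rewrite mxE hxy /param_var; case: insubP => [q _ _|/negP []] //; by exists (enum_rank q).
Qed.

Lemma comp_matrix_nedge x y : y != x -> ~~ edge M x y -> A y x = 0.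
Proof.
move=> hxy h; rewrite mxE (negPf hxy) /param_var; case: insubP => // q hq.
by rewrite /is_param (negPf h) in hq.
Qed.

(** As all compartments leak, the indeterminates can be substituted so that the
    compartmental matrix becomes any given matrix supported by the graph. *)
Lemma comp_matrix_subst (K : nat) (T : 'M[{mpoly R[K]}]_n) :
  (forall x y, y != x -> ~~ edge M x y -> T y x = 0) ->
  exists d : P.-tuple {mpoly R[K]}, forall x y, A y x \mPo d = T y x.
Proof.
move=> hT.
pose val (q : option 'I_n * 'I_n) := match q.1 with
  | Some y => T y q.2
  | None => - T q.2 q.2 - \sum_(y | edge M q.2 y) T y q.2 end.
pose d := [tuple val (\val (enum_val l : param M)) | l < P].
have var q : is_param M q -> param_var R M q \mPo d = val q.
  move=> hq; rewrite /param_var insubT comp_mpolyXU -tnth_nth tnth_mktuple.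
  by rewrite enum_rankK.
exists d => x y; case: (eqVneq y x) => [->|hyx].
  rewrite mxE eqxx comp_mpolyB comp_mpolyN var; last by rewrite /= hLeak inE.
  rewrite [X in _ - X](raddf_sum (comp_mpoly d)) /=.
  rewrite (eq_bigr (fun y => T y x)) => [|y' hy']; last by rewrite var.
  by rewrite /val /=; ring.
case: (boolP (edge M x y)) => [h|h]; last first.
  by rewrite comp_matrix_nedge // hT // comp_mpoly0.
by rewrite mxE (negPf hyx) var.
Qed.

(** Value of a coefficient, read off the list of values of the coefficients, from
    which 0 and 1 are missing. *)
Definition coef_value (cs : seq R) (p : {mpoly R[P]}) : R :=
  if p == 0 then 0 else if p == 1 then 1 else nth 0 cs (index p (io_coefs R M)).

Lemma coef_valueE theta p :
  (p = 0 \/ p \in (io_lhs R M : seq _) \/ p \in (io_rhs R M i j : seq _)) ->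
  coef_value (Defs.coef_map theta) p = p.@[theta].
Proof.
move=> hp; rewrite /coef_value; case: eqVneq hp => [->|p0] hp; first by rewrite meval0.
case: eqVneq => [->|p1]; first by rewrite meval1.
have hin : p \in io_coefs R M.
  rewrite mem_filter p0 p1 /=; apply/flattenP.
  exists ((io_lhs R M : seq _) ++
          flatten [seq (io_rhs R M i' j : seq _) | i' <- enum (In M)]).
    by apply/mapP; exists j => //; rewrite mem_enum hOut inE.
  rewrite mem_cat; case: hp => [/eqP h|[->//|h]]; first by rewrite h in p0.
  apply/orP; right; apply/flattenP; exists (io_rhs R M i j : seq _) => //.
  by apply/mapP; exists i => //; rewrite mem_enum hIn inE.
by rewrite (nth_map 0) ?index_mem // nth_index.
Qed.

(** The coefficients of the input-output equation, of both sides alternately. *)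
Definition io_coef l : {mpoly R[P]} :=
  interleave (io_lhs R M : seq _) (io_rhs R M i j) l.

Lemma io_coefP l :
  io_coef l = 0 \/ io_coef l \in (io_lhs R M : seq _) \/
  io_coef l \in (io_rhs R M i j : seq _).
Proof.
rewrite /io_coef /interleave; case: ifP => _.
  case: (ltnP l./2 (size (io_rhs R M i j))) => h; last by left; apply: nth_default.
  by right; right; apply: mem_nth.
case: (ltnP l./2 (size (io_lhs R M))) => h; last by left; apply: nth_default.
by right; left; apply: mem_nth.
Qed.

(** A numbering of the vertices as given by [vertex_numbering]. *)
Variables (t : {perm 'I_n}) (u r : nat -> nat).
Hypothesis u_lt : forall v, (2 <= v)%N -> (u v < v)%N.
Hypothesis r_lt : forall v, (2 <= v)%N -> (r v < v)%N.
Hypothesis t0 : forall x : 'I_n, x = 0%N :> nat -> t x = i.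
Hypothesis t1 : forall x : 'I_n, x = 1%N :> nat -> t x = j.
Hypothesis edge_t : forall x y : 'I_n, edge M (t y) (t x) =
  [|| (x == 1%N :> nat) && (y == 0%N :> nat), (2 <= y)%N && (x == r y :> nat)
    | (2 <= x)%N && (y == u x :> nat)].

Local Notation lhs := (slice_lhs R u r k).
Local Notation rhs := (slice_rhs R u r k).
Definition slice_coef l : {mpoly R[N]} := interleave (lhs : seq _) rhs l.

Lemma t_inord0 : t (inord 0) = i. Proof. by apply: t0; rewrite inordK. Qed.
Lemma t_inord1 : t (inord 1) = j. Proof. by apply: t1; rewrite inordK. Qed.

Lemma io_lhsE (S : comNzRingType) (f : {rmorphism {mpoly R[P]} -> S}) :
  map_poly f (io_lhs R M) = char_poly (map_mx f A).
Proof. exact: map_char_poly. Qed.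

Lemma io_rhsE (S : comNzRingType) (f : {rmorphism {mpoly R[P]} -> S}) :
  map_poly f (io_rhs R M i j) = \adj (char_poly_mx (map_mx f A)) j i.
Proof. by rewrite -map_char_poly_mx -map_mx_adj [RHS]mxE [X in _ = _ X]mxE. Qed.

(** Setting the in-edges to 1 specialises the coefficients of the equation of
    the model to those of the slice. *)
Lemma slice_subst : exists d : P.-tuple {mpoly R[N]},
  forall l, io_coef l \mPo d = slice_coef l.
Proof.
pose T : 'M[{mpoly R[N]}]_n := \matrix_(y, x) slice_mx R u r k (t^-1%g y) (t^-1%g x).
have [|d hd] := @comp_matrix_subst _ T.
  move=> x y hyx; rewrite -{1}[x](permKV t) -{1}[y](permKV t) edge_t 2!mxE.
  set x' := (t^-1)%g x; set y' := (t^-1)%g y => h.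
  have hxy : y' != x' by rewrite (inj_eq perm_inj).
  rewrite /slice_entry val_eqE (negPf hxy).
  move: h; rewrite !negb_or => /and3P [/negPf -> /negPf -> /negPf ->].
  by [].
have mapA : map_mx (comp_mpoly d) A = T by apply/matrixP => y x; rewrite mxE hd.
have [|hc ha] := @renumber_char_poly _ _ T (slice_mx R u r k) t.
  by move=> x y; rewrite [RHS]mxE !permK.
have eL : lhs = map_poly (comp_mpoly d) (io_lhs R M).
  by rewrite io_lhsE mapA; exact: hc.
have eR : rhs = map_poly (comp_mpoly d) (io_rhs R M i j).
  by rewrite io_rhsE mapA -t_inord0 -t_inord1; exact: ha.
by exists d => l; rewrite /slice_coef eL eR interleave_map.
Qed.

(** Rescaling the compartments other than i and j by D makes the parameter of
    u v -> v equal to 1 for all v >= 2: D v is found from D (u v). *)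
Lemma gauge_fixing theta : (forall x y, edge M x y -> (A y x).@[theta] != 0) ->
  exists z D : nat -> R,
    [/\ D 0%N = 1, D 1%N = 1, forall x : 'I_n, D x != 0 &
        forall x y : 'I_n, slice_entry u r z x y * D y
                           = D x * (A (t x) (t y)).@[theta]].
Proof.
move=> hA; pose B x y := (A (t (inord x)) (t (inord y))).@[theta].
have Bu x : (2 <= x)%N -> (x < n)%N -> B x (u x) != 0.
  move=> hx hxn; have hu := u_lt hx; apply: hA; rewrite edge_t.
  by rewrite !inordK ?hx ?eqxx ?orbT //; apply: ltn_trans hxn.
have rec m : (m <= n)%N -> exists D : nat -> R,
    [/\ D 0%N = 1, D 1%N = 1, forall x, (x < m)%N -> D x != 0 &
        forall x, (2 <= x)%N -> (x < m)%N -> D x * B x (u x) = D (u x)].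
  elim: m => [_|m IH hm]; first by exists (fun=> 1).
  have [D [D0 D1 Dn0 Du]] := IH (ltnW hm).
  case: (ltnP m 2) => m2.
    exists D; split => //; last by move=> x h1 h2; lia.
    by case=> [|[|x]] hx; rewrite ?D0 ?D1 ?oner_neq0 //; lia.
  have um := u_lt m2.
  exists (fun x => if x == m then D (u m) / B m (u m) else D x); split.
  - by rewrite D0; case: eqP => // h; lia.
  - by rewrite D1; case: eqP => // h; lia.
  - move=> x hx; case: (x =P m) => [_|h]; last by apply: Dn0; lia.
    by rewrite mulf_neq0 ?invr_neq0 ?Bu ?Dn0.
  move=> x hx hxm; case: (x =P m) => [->|h].
    by rewrite ltn_eqF // mulfVK // Bu.
  have hx' : (x < m)%N by lia.
  by rewrite ltn_eqF ?Du //; apply: ltn_trans hx'; apply: u_lt.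
have [D [D0 D1 Dn0 Du]] := rec n (leqnn n).
pose z l := D (coord_row r l) * B (coord_row r l) (coord_col l) / D (coord_col l).
exists z, D; split => //; first by move=> x; apply: Dn0.
move=> x y.
have BE : (A (t x) (t y)).@[theta] = B x y by rewrite /B !inord_val.
have B0 : x != y -> ~~ edge M (t y) (t x) -> B x y = 0.
  by move=> hxy h; rewrite -BE comp_matrix_nedge ?meval0 // (inj_eq perm_inj).
rewrite BE; have Dy : D y != 0 by apply: Dn0.
rewrite /slice_entry; case: (eqVneq (x : nat) y) => [e|hxy].
  by rewrite /z /coord_row /coord_col odd_double doubleK e mulfVK.
case: ifP => [/andP [/eqP hx /eqP hy]|h1].
  by rewrite /z /coord_row /coord_col /= hx hy mulfVK // -hy.
case: ifP => [/andP [hy /eqP hx]|h2].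
  have zE : coord_row r y.*2.-1 = x /\ coord_col y.*2.-1 = y.
    rewrite hx /coord_row /coord_col; case: (y : nat) hy => [|[|y']] // _.
    by rewrite doubleS /= odd_double /= uphalf_double.
  by rewrite /z !(proj1 zE) !(proj2 zE) mulfVK.
case h3: ((1 < x)%N && (y == u x :> nat)).
  by case/andP: h3 => hx /eqP hy; rewrite mul1r hy Du.
by rewrite mul0r B0 ?mulr0 // edge_t h1 h2 h3.
Qed.

(** The monomial of a cycle or path, on the slice. *)
Definition slice_monomial (s : seq ('I_n * 'I_n)) : {mpoly R[N]} :=
  \prod_(xy <- s) slice_mx R u r k (t^-1%g xy.2) (t^-1%g xy.1).

(** Where no edge parameter vanishes, the values of the coefficients, the cycles
    and the paths are attained together at a point of the slice. *)
Lemma slice_values theta : (forall x y, edge M x y -> (A y x).@[theta] != 0) ->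
  exists v : 'I_N -> R,
    (forall l, (slice_coef l).@[v] = (io_coef l).@[theta]) /\
    (forall s, path_or_cycle M s ->
       (slice_monomial s).@[v] = (monomial R M s).@[theta]).
Proof.
move=> /gauge_fixing [z [D [D0 D1 Dn0 hD]]]; exists (fun l => z l).
set v := fun _ => _.
have mapS : map_mx (meval v) (slice_mx R u r k) = nat_mx n (slice_entry u r z).
  exact: map_slice_mx.
have [//|x y|hc ha] := @gauge_char_poly _ _ (map_mx (meval theta) A)
    (nat_mx n (slice_entry u r z)) (fun x => D x) t.
  by rewrite [X in X * _]mxE [X in _ = _ * X]mxE; apply: hD.
split=> [l|s hs].
  rewrite /slice_coef /io_coef -2!interleave_map; congr (interleave _ _ _).
    by rewrite io_lhsE -hc -mapS -map_char_poly.
  have e0 : (D (inord 0 : 'I_n))%:P = 1 by rewrite inordK // D0 polyC1.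
  have e1 : (D (inord 1 : 'I_n))%:P = 1 by rewrite inordK // D1 polyC1.
  have e : \adj (char_poly_mx (nat_mx n (slice_entry u r z))) (inord 1) (inord 0)
      = map_poly (meval theta) (io_rhs R M i j).
    rewrite io_rhsE -t_inord0 -t_inord1 -[LHS]mulr1 -[RHS]mul1r -{1}e0 -{1}e1.
    exact: ha.
  by rewrite -e -mapS -map_char_poly_mx -map_mx_adj; congr polyseq; rewrite [RHS]mxE.
pose d x := D (t^-1%g x).
have d0 x : d x != 0 by apply: Dn0.
have di : d i = 1 by rewrite /d -t_inord0 permK inordK.
have dj : d j = 1 by rewrite /d -t_inord1 permK inordK.
have hd : \prod_(xy <- s) d xy.2 = \prod_(xy <- s) d xy.1.
  (* telescoping products *)
  case: s / hs => [x|c _|i' j' p]; first by rewrite !big_seq1.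
    exact: prod_cycle_arcs.
  rewrite hIn hOut !inE => /eqP -> /eqP -> [_ hl _].
  by have := prod_path_arcs d i p; rewrite hl di dj mul1r mulr1.
rewrite /slice_monomial /monomial !rmorph_prod /=.
have hp : \prod_(xy <- s) d xy.1 != 0.
  by rewrite prodf_seq_neq0; apply/allP => xy _ /=; apply: d0.
apply: (mulIf hp); rewrite -[in RHS]hd -!big_split; apply: eq_bigr => xy _ /=.
have := hD (t^-1%g xy.2) (t^-1%g xy.1); rewrite !permKV -/(d _) -/(d _) mulrC => h.
rewrite [RHS]mulrC -h mulrC; congr (_ * _).
by have /matrixP /(_ (t^-1%g xy.2) (t^-1%g xy.1)) := mapS; rewrite !mxE => ->.
Qed.

Lemma path_cycle_identifiable s : path_or_cycle M s ->
  locally_identifiable (M := M) (fun theta => (monomial R M s).@[theta]).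
Proof.
move=> hs.
have [g hg] := slice_coefs_independent R u_lt r_lt k.
pose c := [tuple slice_coef (g l) | l < N].
have [D [q [[b0 qb0] hq]]] := algebraic_relation c (slice_monomial s).
pose cf := [tuple io_coef (g l) | l < N].
pose edges := \prod_(xy : 'I_n * 'I_n | edge M xy.1 xy.2) A xy.2 xy.1.
(* the relation, with the values of the coefficients substituted *)
pose rel (cs : seq R) : {poly R} :=
  \poly_(b < D) (if insub b is Some b' then
     (q b').@[fun l => coef_value cs (tnth cf l)] else 0).
have relE (theta : 'I_P -> R) (b : 'I_D) :
    (rel (Defs.coef_map theta))`_b = (q b \mPo cf).@[theta].
  rewrite coef_poly ltn_ord -[insub _]/(insub (val b)) valK comp_mpoly_meval.
  apply: meval_eq => l; rewrite coef_valueE // tnth_mktuple.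
  exact: io_coefP.
exists ((q b0 \mPo cf) * edges), (fun cs => polyrcf.rootsR (rel cs)); split.
  apply: mulf_neq0.
    have [d hd] := slice_subst; apply: contraNneq qb0 => h; apply/eqP/hg.
    transitivity ((q b0 \mPo cf) \mPo d); last by rewrite h comp_mpoly0.
    rewrite comp_mpoly_comp; congr comp_mpoly.
    by apply: eq_from_tnth => l; rewrite !tnth_mktuple hd.
  apply/prodf_neq0 => -[x y] /comp_matrix_edge [l /= ->].
  apply/eqP => /(congr1 (mcoeff U_(l))); rewrite mcoeffX eqxx mcoeff0.
  by move/eqP; rewrite oner_eq0.
move=> theta; rewrite mevalM mulf_eq0 negb_or => /andP [hq0 he].
have [|v [hv hvs]] := @slice_values theta.
  move=> x y hxy; apply: contra he => /eqP h.
  by rewrite rmorph_prod /= (bigD1 (x, y)) //= h mul0r.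
have rel0 : rel (Defs.coef_map theta) != 0.
  by apply: contraNneq hq0 => h; rewrite -relE h coef0.
have := polyrcf.roots_on_rootsR rel0.
move=> /(_ (monomial R M s).@[theta]) <-; rewrite inE /=.
rewrite rootE -hvs // (horner_coef_wide _ (size_poly _ _)).
apply/eqP; have := congr1 (meval v) hq; rewrite meval0 raddf_sum /=.
apply: etrans; apply: eq_bigr => b _.
rewrite relE mevalM rmorphXn /=; congr (_ * _).
rewrite !comp_mpoly_meval; apply: meval_eq => l.
by rewrite !tnth_mktuple hv.
Qed.

End Model.

Theorem theorem3p22 (R : realType) (n : nat) (M : model n) (i j : 'I_n)
    (hij : i != j)
    (hIn : In M = [set i]) (hOut : Out M = [set j])
    (hLeak : Leak M = [set: 'I_n])
    (hconn : strongly_io_connected (edge M) (In M) (Out M))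
    (hE : num_edges (edge M) = (2 * n - (dist (edge M) i j + 2))%N)
    (hji : ~~ connect (edge M) j i)
    (hisc : inductively_strongly_connected (add_edge (edge M) j i) i) :
  identifiable_path_cycle_model R M.
Proof.
split => //; last first.
  move=> x y; case: eqVneq => [<- _|_ /= hxy].
    by exists [:: (x, x)]; [apply: SelfCycle | rewrite inE].
  have [_ /(_ x y hxy) [[c hc hin]|[i' [j' [p [hi hj hp hin]]]]]] := hconn.
    by exists (cycle_arcs c); first exact: Cycle.
  by exists (path_arcs i' p); first exact: IOPath hi hj hp.
have [t [u [r [u_lt r_lt t0 t1 edge_t]]]] :=
  vertex_numbering (edge_irr M) hij hE hji hisc.
case: n M i j hij hIn hOut hLeak {hconn hE hji hisc} t t0 t1 edge_t
  => [|[|k]] M i j hij hIn hOut hLeak t t0 t1 edge_t s hs.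
- by case: i {hij hIn t0}.
- by move: hij; rewrite (ord1 i) (ord1 j) eqxx.
exact: (path_cycle_identifiable R hIn hOut hLeak u_lt r_lt t0 t1 edge_t).
Qed.
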